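(* Let $h$ be a nonconstant rational $\Gamma$-inner function. Then either $h(\overline{\mathbb D})=\mathcal R\cap\Gamma$, or $h(\overline{\mathbb D})$ meets $\mathcal R$ exactly $\deg(h)$ times, meaning that the sum of the multiplicities of the royal nodes of $h$ in $\overline{\mathbb D}$ equals $\deg(h)$.
   Context: $\mathbb D$ is the open unit disc in $\mathbb C$ and $\mathbb T$ the unit circle. $\mathcal G=\{(z+w,zw):z,w\in\mathbb D\}\subset\mathbb C^2$, $\Gamma=\overline{\mathcal G}$, and $b\Gamma$ is the distinguished boundary of $\Gamma$, i.e. the smallest closed subset of $\Gamma$ on which every continuous function on $\Gamma$ that is analytic in $\mathcal G$ attains its maximum modulus; explicitly $b\Gamma=\{(s,p)\in\mathbb C^2:|s|\le2,\ |p|=1,\ s=\overline s p\}$. A rational $\Gamma$-inner function is a rational analytic map $h=(s,p):\mathbb D\to\Gamma$ whose (continuous) extension to $\overline{\mathbb D}$ maps $\mathbb T$ into $b\Gamma$. Its degree $\deg(h)$ is the nonnegative integer $|h_*(1)|$, where $h_*:\mathbb Z=\pi_1(\mathbb T)\to\pi_1(b\Gamma)\cong\mathbb Z$ is induced by $h|_{\mathbb T}:\mathbb T\to b\Gamma$. The royal variety is $\mathcal R=\{(2z,z^2):z\in\mathbb C\}=\{(s,p)\in\mathbb C^2:s^2=4p\}$. A royal node of $h$ is a point $\lambda\in\overline{\mathbb D}$ with $h(\lambda)\in\mathcal R$. For a polynomial $f$ of degree at most $n$ put $f^{\sim n}(\lambda)=\lambda^n\overline{f(1/\overline\lambda)}$.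 If $h=(s,p)$ is rational $\Gamma$-inner of degree $n$, there are polynomials $E,D$ of degree at most $n$, unique up to a common nonzero real factor, with $E^{\sim n}=E$, $D\ne0$ on $\overline{\mathbb D}$, $|E|\le2|D|$ on $\overline{\mathbb D}$, $s=E/D$ and $p=D^{\sim n}/D$ on $\overline{\mathbb D}$. The royal polynomial of $h$ is $R=4DD^{\sim n}-E^2$ (determined up to a positive factor). The royal nodes of $h$ are exactly the zeros of $R$ in $\overline{\mathbb D}$, and zeros of $R$ on $\mathbb T$ have even or infinite order. When $h(\overline{\mathbb D})\not\subseteq\mathcal R\cap\Gamma$, the multiplicity of a royal node $\sigma$ that is a zero of $R$ of order $\ell$ is $\ell$ if $\sigma\in\mathbb D$ and $\ell/2$ if $\sigma\in\mathbb T$. *)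

(* Defs.v *)
From HB Require Import structures.
From mathcomp Require Import all_boot all_order all_algebra.
From mathcomp Require Import complex.
From mathcomp Require Import all_classical all_reals all_analysis.
Set Implicit Arguments.
Unset Strict Implicit.
Unset Printing Implicit Defensive.
Import Order.TTheory GRing.Theory Num.Theory numFieldNormedType.Exports.
Local Open Scope classical_set_scope.
Local Open Scope ring_scope.

(* Viewing [R[i]] as a [numClosedFieldType] gives it the norm topology (and
   [Cplx R * Cplx R] the product topology) by inference.  Norms take their
   values in [Cplx R], where [a <= b] means that [b - a] is a nonnegative
   real. *)
Definition Cplx (R : realType) : numClosedFieldType := R[i].

(* The fundamental group, on representatives: loops are functions on the whole
   of [R], of which only the values on [0, 1] matter. *)
Section FundamentalGroup.
Context {R : realType} {T : topologicalType}.
Implicit Types (A : set T) (x : T) (a b : R -> T).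

Definition is_loop A x a : Prop :=
  [/\ {within `[0, 1], continuous a}, a 0 = x, a 1 = x &
      forall t : R, 0 <= t <= 1 -> A (a t)].

Definition loop_homotopic A x a b : Prop :=
  exists H : R * R -> T,
    [/\ {within `[0, 1] `*` `[0, 1], continuous H},
        forall t : R, 0 <= t <= 1 -> H (0, t) = a t /\ H (1, t) = b t &
        forall u : R, 0 <= u <= 1 -> is_loop A x (fun t => H (u, t))].

Definition loop_mul a b : R -> T :=
  fun t => if t <= 2^-1 then a (2 * t) else b (2 * t - 1).

(* [phi] induces a group isomorphism from pi_1(A, x) onto the integers. *)
Definition pi1_iso_int A x (phi : (R -> T) -> int) : Prop :=
  [/\ forall a b, is_loop A x a -> is_loop A x b ->
        (phi a = phi b <-> loop_homotopic A x a b),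
      forall a b, is_loop A x a -> is_loop A x b ->
        phi (loop_mul a b) = phi a + phi b &
      forall k : int, exists2 a, is_loop A x a & phi a = k].

End FundamentalGroup.

(* f^{~n}, for [f] of degree at most [n]; see [revpoly_horner]. *)
Definition revpoly (F : numClosedFieldType) (n : nat) (f : {poly F}) :
  {poly F} := \poly_(i < n.+1) (f`_(n - i))^*.

Lemma revpoly_horner (F : numClosedFieldType) n (f : {poly F}) (z : F) :
  (size f <= n.+1)%N -> z != 0 ->
  (revpoly n f).[z] = z ^+ n * (f.[(z^*)^-1])^*.
Proof.
move=> sf z0; rewrite /revpoly horner_poly (horner_coef_wide _ sf).
rewrite rmorph_sum mulr_sumr (reindex_inj rev_ord_inj) /=.
apply: eq_bigr => i _; have lein : (i <= n)%N by rewrite -ltnS.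
rewrite subSS subKn // rmorphM rmorphXn fmorphV /= conjCK mulrCA.
by rewrite expfB_cond ?exprVn // (negPf z0) add0n.
Qed.

Section SymmetrizedBidisc.
Context {R : realType}.
Local Notation C := (Cplx R).
Implicit Types (h : C -> C * C) (z : C) (n : nat) (E D : {poly C}).

Definition disc : set C := [set z | `|z| < 1].
Definition cdisc : set C := [set z | `|z| <= 1].
Definition circle : set C := [set z | `|z| = 1].

Definition sym_bidisc : set (C * C) :=
  [set sp | exists z w : C, [/\ disc z, disc w & sp = (z + w, z * w)]].

Definition Gamma : set (C * C) := closure sym_bidisc.

Definition bGamma : set (C * C) :=
  [set sp | [/\ `|sp.1| <= 2, `|sp.2| = 1 & sp.1 = sp.1^* * sp.2]].

Definition royal_variety : set (C * C) :=
  [set sp | exists z, sp = (2 * z, z ^+ 2)].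

Definition rational_analytic (g : C -> C) : Prop :=
  exists a b : {poly C},
    forall z, disc z -> b.[z] != 0 /\ g z = a.[z] / b.[z].

(* [h] stands for the map together with its continuous extension to the closed
   disc; its values outside the closed disc are irrelevant. *)
Definition rational_Gamma_inner h : Prop :=
  [/\ rational_analytic (fun z => (h z).1),
      rational_analytic (fun z => (h z).2),
      forall z, disc z -> Gamma (h z),
      {within cdisc, continuous h} &
      forall z, circle z -> bGamma (h z)].

Definition nonconstant h : Prop :=
  ~ exists c, forall z, disc z -> h z = c.

(* The generator of the fundamental group of the circle: t |-> exp(2 pi i t) *)
Definition circle_loop (t : R) : C :=
  (cos (2 * pi * t) +i* sin (2 * pi * t))%C.

(* |h_*(1)|.  The isomorphism of the fundamental group of [bGamma] onto the
   integers is unique up to sign, so its choice is immaterial. *)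
Definition degree h : nat :=
  xget 0%N [set n | exists2 phi : (R -> C * C) -> int,
    pi1_iso_int bGamma (h 1) phi & n = `|phi (h \o circle_loop)|%N].

Definition royal_pair h E D : Prop :=
  let n := degree h in
  [/\ (size E <= n.+1)%N, (size D <= n.+1)%N, revpoly n E = E &
      forall z, cdisc z ->
        [/\ D.[z] != 0, `|E.[z]| <= 2 * `|D.[z]| &
            h z = (E.[z] / D.[z], (revpoly n D).[z] / D.[z])]].

(* The pair (E, D) is unique up to a common nonzero real factor, which changes
   the royal polynomial only by a positive factor. *)
Definition royal_poly h : {poly C} :=
  let ED := xget (0, 0) [set ED | royal_pair h ED.1 ED.2] in
  4 *: (ED.2 * revpoly (degree h) ED.2) - ED.1 ^+ 2.

Definition royal_nodes h : set C := [set z | cdisc z /\ royal_variety (h z)].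

(* Meaningful when [h] does not map the closed disc into the royal variety; the
   zeros of the royal polynomial on the circle then have even order. *)
Definition royal_mult h z : nat :=
  let l := mup z (royal_poly h) in if `|z| < 1 then l else l./2.

(* Without finiteness the [\sum] would be 0 by convention; finiteness of the
   set of royal nodes also says that the multiplicities are meaningful. *)
Definition meets_royal_times h n : Prop :=
  finite_set (royal_nodes h) /\
  \sum_(z \in royal_nodes h) royal_mult h z = n.

End SymmetrizedBidisc.

(* Main.v *)
Require Import Defs.
From mathcomp Require Import all_boot all_order all_algebra.
From mathcomp Require Import complex.
From mathcomp Require Import all_classical all_reals all_analysis.
From mathcomp Require Import ring lra zify.
Import Order.TTheory GRing.Theory Num.Theory numFieldNormedType.Exports.
Local Open Scope classical_set_scope.
Local Open Scope ring_scope.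

Set Implicit Arguments.
Unset Strict Implicit.
Unset Printing Implicit Defensive.

(** The statement is a count of zeros. Write [h = (E / D, D~ / D)], where
    [f~ z = z ^+ n * conj (f (1 / conj z))] and [n] is the degree of [h]
    ([royal_pair_exists]). Then [h z] lies on the royal variety exactly when
    [P = 4 D D~ - E ^+ 2] vanishes at [z].

    If [P] is not zero, then [P~ = P] for the formal degree [2 n], so reflection
    in the circle exchanges the zeros of [P] inside and outside the disc, zeros
    at 0 being exchanged with zeros at infinity. Hence twice the number of zeros
    inside plus the number of zeros on the circle is [2 n]
    ([self_reversed_root_count]). On the circle
    [P z / z ^+ n = 4 |D z|^2 - |E z|^2] is nonnegative, so the zeros there
    have even order ([even_multiplicity]) and counting them with half their
    order gives [n].

    If [P] is zero, then [s ^+ 2 = 4 p] on the closed disc and [s / 2] is a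
    rational function of modulus 1 on the circle. Being nonconstant, it is a
    finite Blaschke product of positive degree, so it maps the closed disc onto
    itself ([blaschke_surjective]) and the image of [h = (s, s ^+ 2 / 4)] is
    the whole of the royal variety in [Gamma].

    The existence of [E] and [D] rests on two facts. A rational function in
    lowest terms that has modulus 1 on the circle has the form [D~ / D] up to a
    constant ([unimodular_quotient]); this gives [D] from [p], and the identity
    [s = conj(s) p] on the circle then puts [s] over the same denominator
    ([symmetric_numerator]). It remains to see that the formal degree [n] found
    in this way is the degree of [h], which is defined through the fundamental
    group of [bGamma]. That space is a Moebius band: its points are
    [(x cis (t / 2), cis t)] with [x] real and [|x| <= 2]. A loop in it lifts
    to a path of angles [t] and heights [x], and the total increment of the
    angle, divided by [2 pi], is an isomorphism of the fundamental group onto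
    the integers ([bwinding_iso]). Any other isomorphism is plus or minus this
    one, so the degree of [h] is the absolute value of the winding number of
    [p] along the circle, which is [n] because the zeros of [D] lie outside the
    closed disc ([winding_blaschke]). *)

(** * Reversed polynomials *)

Section Reversal.
Variable F : numClosedFieldType.
Implicit Types (f g p q a b d : {poly F}) (z w c : F) (n m : nat).

Lemma norm1_neq0 z : `|z| = 1 -> z != 0.
Proof. by move=> z1; rewrite -normr_eq0 z1 oner_eq0. Qed.

Lemma norm1_conjV z : `|z| = 1 -> (z^*)^-1 = z.
Proof. by move=> z1; rewrite invC_norm norm_conjC z1 expr1n invr1 mul1r conjCK. Qed.

Lemma norm1_mul_conj z : `|z| = 1 -> z * z^* = 1.
Proof. by move=> z1; rewrite -normCK z1 expr1n. Qed.

(** The Cayley transform of the natural numbers gives infinitely many points of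
    the circle. *)
Lemma poly_eq_circle p q :
  (forall z, `|z| = 1 -> p.[z] = q.[z]) -> p = q.
Proof.
move=> pq; apply/eqP; rewrite -subr_eq0; apply/negPn/negP => nz.
pose t (k : nat) : F := (k%:R + 'i) / (k%:R - 'i).
have d0 (k : nat) : k%:R - 'i != 0 :> F.
  rewrite -normr_gt0 -(@ltr_pXn2r _ 2) ?nnegrE ?normr_ge0 //.
  rewrite normCK rmorphB /= conjC_nat conjCi expr0n /=.
  have -> : (k%:R - 'i) * (k%:R - - 'i) = k%:R ^+ 2 - 'i ^+ 2 :> F by ring.
  by rewrite sqrCi opprK ltr_wpDl ?exprn_ge0 ?ler0n.
have t1 k : `|t k| = 1.
  rewrite /t; have -> : k%:R + 'i = (k%:R - 'i)^* :> F.
    by rewrite rmorphB /= conjC_nat conjCi opprK.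
  by rewrite normrM normfV norm_conjC divff // normr_eq0.
have tinj : injective t.
  move=> k l /eqP; rewrite eqr_div // => /eqP e.
  have : 2 * 'i * (l%:R - k%:R) = 0 :> F.
    transitivity ((k%:R + 'i) * (l%:R - 'i) - (l%:R + 'i) * (k%:R - 'i) : F).
      by ring.
    by rewrite e subrr.
  move/eqP; rewrite !mulf_eq0 pnatr_eq0 /= (negPf (neq0Ci _)) /=.
  by rewrite subr_eq0 eqr_nat => /eqP.
have := @max_poly_roots _ (p - q) [seq t k | k <- iota 0 (size (p - q))] nz.
rewrite size_map size_iota ltnn map_inj_uniq // iota_uniq => h.
suff : false by []; apply: h => //.
apply/allP => _ /mapP[k _ ->]; by rewrite rootE hornerD hornerN pq ?subrr.
Qed.

Lemma coef_revpoly n f i :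
  (revpoly n f)`_i = if (i <= n)%N then (f`_(n - i))^* else 0.
Proof. by rewrite coef_poly ltnS. Qed.

Lemma size_revpoly n f : (size (revpoly n f) <= n.+1)%N.
Proof. exact: size_poly. Qed.

Lemma revpolyZ n c f : revpoly n (c *: f) = c^* *: revpoly n f.
Proof.
by apply/polyP => i; rewrite coefZ !coef_revpoly coefZ; case: ifP;
  rewrite ?rmorphM ?mulr0.
Qed.

Lemma revpoly_circle n f z : (size f <= n.+1)%N -> `|z| = 1 ->
  (revpoly n f).[z] = z ^+ n * (f.[z])^*.
Proof. by move=> sf z1; rewrite revpoly_horner ?norm1_neq0 // norm1_conjV. Qed.

Lemma norm_revpoly_circle n f z : (size f <= n.+1)%N -> `|z| = 1 ->
  `|(revpoly n f).[z]| = `|f.[z]|.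
Proof.
move=> sf z1; rewrite revpoly_circle // normrM normrX z1 expr1n mul1r.
by rewrite norm_conjC.
Qed.

Lemma revpolyM m n f g : (size f <= m.+1)%N -> (size g <= n.+1)%N ->
  revpoly (m + n) (f * g) = revpoly m f * revpoly n g.
Proof.
move=> sf sg; apply: poly_eq_circle => z z1.
have sfg : (size (f * g)%R <= (m + n).+1)%N.
  apply: (leq_trans (size_polyMleq _ _)).
  by rewrite -subn1 leq_subLR add1n -addnS -addSn leq_add.
by rewrite hornerM !revpoly_circle // hornerM rmorphM exprD mulrACA.
Qed.

(** On the circle [z ^+ n * (f.[z])^*] is the value of the reversed polynomial
    whatever the degree of [f]; comparing it with [f] bounds that degree. *)
Lemma self_reversed n f :
  (forall z, `|z| = 1 -> z ^+ n * (f.[z])^* = f.[z]) ->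
  (size f <= n.+1)%N /\ revpoly n f = f.
Proof.
move=> fz; pose M := size f.
have eqX : revpoly (M + n) f = 'X^M * f.
  apply: poly_eq_circle => z z1; rewrite revpoly_circle // ?hornerE.
    by rewrite exprD -mulrA fz.
  by rewrite -addnS leq_addr.
have sf : (size f <= n.+1)%N.
  have [->|f0] := eqVneq f 0; first by rewrite size_poly0.
  have := size_revpoly (M + n) f; rewrite eqX mulrC size_mulXn //.
  by rewrite -addnS leq_add2l.
by split => //; apply: poly_eq_circle => z z1; rewrite revpoly_circle // fz.
Qed.

(** Where [|a| = |b|] one has [a a~ = b b~], so [a] divides [b~] and [b]
    divides [a~] with the same cofactor, which is constant because one of [a]
    and [b] has full degree. *)
Lemma unimodular_quotient a b : coprimep a b ->
  (forall z, `|z| = 1 -> `|a.[z]| = `|b.[z]|) ->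
  exists2 k, `|k| = 1 & revpoly (maxn (size a) (size b)).-1 b = k *: a.
Proof.
move=> cab ab1; set n := _.-1.
have nz z : `|z| = 1 -> a.[z] != 0.
  move=> z1; apply/eqP => az.
  have : `|b.[z]| == 0 by rewrite -ab1 // az normr0.
  have raz : root a z by rewrite rootE az.
  by rewrite normr_eq0 (negPf (coprimep_root cab raz)).
have a0 : a != 0.
  by apply: contraTneq (nz 1 (normr1 _)) => ->; rewrite horner0 eqxx.
have b0 : b != 0.
  apply: contraTneq (nz 1 (normr1 _)) => b0.
  by rewrite -normr_eq0 ab1 ?normr1 // b0 horner0 normr0 eqxx.
have max_gt0 : (0 < maxn (size a) (size b))%N by rewrite leq_max size_poly_gt0 a0.
have sa : (size a <= n.+1)%N by rewrite prednK // leq_maxl.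
have sb : (size b <= n.+1)%N by rewrite prednK // leq_maxr.
have rev : a * revpoly n a = b * revpoly n b.
  apply: poly_eq_circle => z z1; rewrite !hornerM !revpoly_circle //.
  by rewrite mulrCA [RHS]mulrCA -!normCK ab1.
have /dvdpP[u bu] : a %| revpoly n b.
  by rewrite -(Gauss_dvdpr _ cab) -rev dvdp_mulr.
have /dvdpP[v av] : b %| revpoly n a.
  by rewrite coprimep_sym in cab; rewrite -(Gauss_dvdpr _ cab) rev dvdp_mulr.
have uv : u = v.
  have : a * (v * b) = b * (u * a) by rewrite -av -bu.
  rewrite mulrA mulrC [_ * v]mulrC [u * a]mulrC [a * u]mulrC.
  move=> /(mulfI b0)/esym; exact: mulIf.
have u0 : u != 0.
  apply: contraTneq (nz 1 (normr1 _)) => u0.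
  have := norm_revpoly_circle sb (normr1 _); rewrite bu u0 mul0r horner0 normr0.
  by rewrite -ab1 ?normr1 // => /esym/eqP; rewrite normr_eq0 => ->.
have su : (size u <= 1)%N.
  have := size_revpoly n a; have := size_revpoly n b.
  rewrite av bu -uv !size_mul // /n.
  move: a0 b0; rewrite -!size_poly_gt0 /maxn.
  by move: (size u) (size a) (size b) => x y w; clear; case: ifP => _; lia.
move: bu; rewrite (size1_polyC su) mul_polyC => bu.
exists u`_0 => //.
have := norm_revpoly_circle sb (normr1 _); rewrite bu hornerZ normrM.
rewrite ab1 ?normr1 // -[RHS]mul1r => /mulIf; apply.
by rewrite -ab1 ?normr1 // normr_eq0 nz ?normr1.
Qed.

(** Rotating the denominator by a square root of the constant turns
    [b~ = k a] into [D~ / D = a / b]. *)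
Lemma unimodular_quotient_rev a b : coprimep a b ->
  (forall z, `|z| = 1 -> `|a.[z]| = `|b.[z]|) ->
  exists n w, [/\ `|w| = 1, (size b <= n.+1)%N & revpoly n (w *: b) = w *: a].
Proof.
move=> cab ab1; have [k k1 bk] := unimodular_quotient cab ab1.
exists (maxn (size a) (size b)).-1, (sqrtC k).
have w1 : `|sqrtC k| = 1.
  by apply/eqP; rewrite -(@pexpr_eq1 _ _ 2) // -normrX sqrtCK k1.
split=> //; first exact: leq_trans (leq_maxr _ _) (leqSpred _).
by rewrite revpolyZ bk scalerA -{2}(sqrtCK k) expr2 mulrA [_^* * _]mulrC
  norm1_mul_conj // mul1r.
Qed.

(** [f`_0] and [f`_m] are, up to sign, the leading coefficient times the
    product of the roots, and the leading coefficient or 0. *)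
Lemma coef_lt_outer_roots m f : (0 < m)%N -> (size f <= m.+1)%N ->
  (forall z, root f z -> 1 < `|z|) -> `|f`_m| < `|f`_0|.
Proof.
move=> m_gt0 sf rf.
have f0 : f`_0 != 0.
  rewrite -horner_coef0; apply/negP => /rf; by rewrite normr0 ltr10.
have [sm|sm] := leqP (size f) m.
  by rewrite nth_default // normr0 normr_gt0.
have {sf sm} sf : size f = m.+1 by apply/eqP; rewrite eqn_leq sf sm.
have [rs fE] := closed_field_poly_normal f.
have lc0 : lead_coef f != 0 by rewrite lead_coef_eq0 -size_poly_gt0 sf.
have -> : f`_m = lead_coef f by rewrite lead_coefE sf.
have -> : `|f`_0| = `|lead_coef f| * \prod_(z <- rs) `|z|.
  rewrite -horner_coef0 {1}fE hornerZ horner_prod normrM normr_prod.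
  by congr (_ * _); apply: eq_bigr => z _; rewrite !hornerE normrN.
rewrite ltr_pMr ?normr_gt0 //.
have rs_gt1 z : z \in rs -> 1 < `|z|.
  by move=> zrs; apply: rf; rewrite fE rootZ // root_prod_XsubC.
have : (0 < size rs)%N.
  by have := size_prod_XsubC rs id; rewrite -(size_scale _ lc0) -fE sf => -[<-].
elim: rs rs_gt1 {fE} => // z [|y s] IH rs_gt1 _.
  by rewrite big_seq1 rs_gt1 ?mem_head.
rewrite big_cons; apply: (lt_trans (rs_gt1 z (mem_head _ _))).
rewrite ltr_pMr; last by apply: lt_trans (rs_gt1 z (mem_head _ _)).
by apply: IH => // x xs; apply: rs_gt1; rewrite inE xs orbT.
Qed.

(** A nonconstant finite Blaschke product [B~ / B] takes every value of the
    closed disc there: for [f = B~ - c B] one computes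
    [|f_m|^2 - |f_0|^2 = (1 - |c|^2) (|B_0|^2 - |B_m|^2) >= 0], so not all the
    zeros of [f] are outside the closed disc. *)
Lemma blaschke_surjective m b c : (0 < m)%N -> (size b <= m.+1)%N ->
  (forall z, root b z -> 1 < `|z|) -> `|c| <= 1 ->
  exists2 z, `|z| <= 1 & (revpoly m b).[z] = c * b.[z].
Proof.
move=> m_gt0 sb rb c1; pose f := revpoly m b - c *: b.
apply: contrapT => no.
have /(coef_lt_outer_roots m_gt0) : (size f <= m.+1)%N.
  rewrite (leq_trans (size_polyD _ _)) // geq_max size_revpoly size_polyN.
  exact: leq_trans (size_scale_leq _ _) sb.
have b_lt := coef_lt_outer_roots m_gt0 sb rb.
have out z : root f z -> 1 < `|z|.
  move=> rz; rewrite real_ltNge ?rpred1 ?normr_real //; apply/negP => z1.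
  apply: no; exists z => //; apply/eqP; rewrite -subr_eq0.
  by move: rz; rewrite rootE !hornerE.
move=> /(_ out).
rewrite !coefB !coefZ !coef_revpoly leqnn leq0n subnn subn0.
apply/negP; rewrite -real_leNgt ?normr_real //.
rewrite -ler_sqr ?nnegrE ?normr_ge0 // -subr_ge0.
set x := b`_0 in b_lt *; set y := b`_m in b_lt *.
have -> : `|x^* - c * y| ^+ 2 - `|y^* - c * x| ^+ 2 =
    (1 - `|c| ^+ 2) * (`|x| ^+ 2 - `|y| ^+ 2).
  by rewrite !normCK !rmorphB !rmorphM /= !conjCK; ring.
rewrite mulr_ge0 // subr_ge0; first by rewrite expr_le1.
by rewrite ler_sqr ?nnegrE ?normr_ge0 // ltW.
Qed.

(** The symmetry [s = conj(s) p] of [s = a / b] on the circle makes [b] divide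
    the denominator of [p], because the reflected polynomial [b~] has its zeros
    on the other side of the circle. *)
Lemma symmetric_numerator n a b d : coprimep a b -> (size d <= n.+1)%N ->
  (forall z, root b z -> 1 < `|z|) ->
  (forall z, `|z| = 1 ->
     a.[z] * (b.[z])^* * d.[z] = (a.[z])^* * b.[z] * (revpoly n d).[z]) ->
  exists2 g, d = g * b &
    (size (g * a)%R <= n.+1)%N /\ revpoly n (g * a) = g * a.
Proof.
move=> cab sd rb sym; pose N := maxn (size a) (size b).
have sa : (size a <= N.+1)%N by rewrite leqW // leq_maxl.
have sb : (size b <= N.+1)%N by rewrite leqW // leq_maxr.
have bnz z : `|z| <= 1 -> b.[z] != 0.
  move=> z1; apply/negP => /rb; by rewrite real_ltNge ?rpred1 ?normr_real // z1.
have eqp : b * (revpoly N a * revpoly n d) = a * (revpoly N b * d).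
  apply: poly_eq_circle => z z1; rewrite !hornerM [in LHS](revpoly_circle sa z1).
  rewrite (revpoly_circle sb z1).
  transitivity (z ^+ N * (a.[z] * (b.[z])^* * d.[z])); last by ring.
  by rewrite sym //; ring.
have cbb : coprimep b (revpoly N b).
  apply: Pdiv.ClosedField.root_coprimep => z /rb z1.
  have z0 : z != 0 by rewrite -normr_gt0 (lt_trans ltr01).
  rewrite revpoly_horner // mulf_neq0 ?expf_neq0 // conjC_eq0 bnz //.
  rewrite normfV norm_conjC invf_le1 ?ltW //; exact: lt_trans z1.
have /dvdpP[g dg] : b %| d.
  rewrite -(Gauss_dvdpr _ cbb) -(@Gauss_dvdpr _ _ a) 1?coprimep_sym //.
  by rewrite -eqp dvdp_mulr.
exists g => //; apply: self_reversed => z z1.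
have := sym z z1; rewrite (revpoly_circle sd) // {2}dg.
have := bnz z; rewrite z1 lexx => /(_ isT) bz.
rewrite dg !hornerM !rmorphM /= => e.
have bz' : (b.[z])^* != 0 by rewrite conjC_eq0.
apply: (mulfI bz'); apply: (mulfI bz).
transitivity ((a.[z])^* * b.[z] * (z ^+ n * ((g.[z])^* * (b.[z])^*))); first by ring.
by rewrite -e; ring.
Qed.

Lemma revpoly_prod_XsubC (s : seq F) :
  revpoly (size s) (\prod_(z <- s) ('X - z%:P)) = \prod_(z <- s) (1 - z^* *: 'X).
Proof.
elim: s => [|z s IH] /=.
  rewrite !big_nil; apply/polyP => i; rewrite coef_revpoly !coef1.
  by case: i => [|i] //=; rewrite rmorph1.
rewrite !big_cons -IH -addn1 addnC revpolyM ?size_XsubC //.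
  congr (_ * _); apply: poly_eq_circle => w w1.
  rewrite revpoly_circle ?size_XsubC // !hornerE rmorphB /= mulrBr.
  by rewrite norm1_mul_conj // mulrC.
by rewrite size_prod_XsubC.
Qed.

(** Reflection in the circle maps the zeros of a self-reversed polynomial to
    its zeros, a zero at 0 making up for the missing degree. *)
Lemma self_reversed_root_count N p (rs : seq F) :
  p = lead_coef p *: \prod_(z <- rs) ('X - z%:P) -> p != 0 ->
  (size p <= N.+1)%N -> revpoly N p = p ->
  (2 * count (fun z => `|z| < 1)%R rs + count (fun z => `|z| == 1)%R rs)%N = N.
Proof.
move=> pE p0 sp rp.
have lc0 : lead_coef p != 0 by rewrite lead_coef_eq0.
have srs : size p = (size rs).+1 by rewrite pE size_scale // size_prod_XsubC.
have leN : (size rs <= N)%N by rewrite -ltnS -srs.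
pose refl z := (z^*)^-1.
pose ts := nseq (N - size rs) 0 ++ [seq refl z | z <- rs & z != 0].
have [c pc] : exists c, p = c *: \prod_(z <- ts) ('X - z%:P).
  pose c := (lead_coef p)^* * \prod_(z <- rs | z != 0) (- z^*).
  exists c; rewrite -{1}rp {1}pE revpolyZ -{1}(subnK leN).
  rewrite -[X in revpoly _ X]mul1r revpolyM ?size_poly1 //; last first.
    by rewrite size_prod_XsubC.
  rewrite revpoly_prod_XsubC /c -scalerA; congr (_ *: _).
  rewrite /ts big_cat big_nseq /= subr0 iter_mulr_1 scalerAr; congr (_ * _).
    apply/polyP => i; rewrite coef_revpoly coefXn coef1.
    case: ltngtP => //= [lt|->]; last by rewrite subnn rmorph1.
    by rewrite subn_eq0 leqNgt lt rmorph0.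
  rewrite big_map big_filter; elim: (rs) => [|z s IH].
    by rewrite !big_nil scale1r.
  rewrite !big_cons; case: eqVneq => [->|z0] /=.
    by rewrite conjC0 scale0r subr0 mul1r.
  have -> : 1 - z^* *: 'X = (- z^*) *: ('X - (refl z)%:P) :> {poly F}.
    rewrite scaleNr scalerBr opprB -[(refl z)%:P]alg_polyC scalerA divff ?conjC_eq0 //.
    by rewrite scale1r.
  by rewrite IH -scalerAl -scalerAr scalerA.
have perm : perm_eq rs ts.
  apply: prod_XsubC_eq; apply: (scalerI lc0); rewrite -pE {1}pc; congr (_ *: _).
  by rewrite pc lead_coefZ (monicP (monic_prod_XsubC _ _ _)) mulr1.
have cnt : count (fun z => `|z| < 1)%R rs =
    (N - size rs + count (fun z => 1 < `|z|)%R rs)%N.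
  rewrite (permP perm) /ts count_cat count_nseq normr0 ltr01 mul1n; congr addn.
  rewrite count_map count_filter; apply: eq_count => z /=.
  have [->|z0] /= := eqVneq z 0; first by rewrite andbF normr0 ltr10.
  by rewrite andbT normfV norm_conjC invf_lt1 // normr_gt0.
have tot : (count (fun z => `|z| < 1)%R rs + count (fun z => `|z| == 1)%R rs +
    count (fun z => 1 < `|z|)%R rs)%N = size rs.
  elim: (rs) => //= z s IH; rewrite -IH.
  by case: (real_ltgtP (normr_real z) (rpred1 _)) => /= _; lia.
by lia.
Qed.


End Reversal.

(** * Complex numbers of modulus 1 *)

Section ComplexNumbers.
Context {R : realType}.
Local Notation C := (Cplx R).
Implicit Types (x y t : R) (z w : C).

Definition cis t : C := (cos t +i* sin t)%C.

Lemma cisD t u : cis (t + u) = cis t * cis u.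
Proof.
by rewrite /cis cosD sinD; apply/eqP; rewrite eq_complex /= eqxx addrC eqxx.
Qed.

Lemma cis0 : cis 0 = 1. Proof. by rewrite /cis cos0 sin0. Qed.

Lemma conj_cis t : (cis t)^* = cis (- t).
Proof. by rewrite /cis cosN sinN. Qed.

Lemma cis_mul_conj t : cis t * (cis t)^* = 1.
Proof. by rewrite conj_cis -cisD subrr cis0. Qed.

Lemma norm_cis t : `|cis t| = 1.
Proof. by apply/eqP; rewrite -(@pexpr_eq1 _ _ 2) // normCK cis_mul_conj. Qed.

Lemma cis_neq0 t : cis t != 0.
Proof. by rewrite -normr_eq0 norm_cis oner_eq0. Qed.

Lemma cis_inv t : (cis t)^-1 = cis (- t).
Proof. by apply: (mulfI (cis_neq0 t)); rewrite divff ?cis_neq0 // -cisD subrr cis0. Qed.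

Lemma real_conj x : ((x%:C)%C : C)^* = x%:C%C.
Proof. exact: conjc_real. Qed.

Lemma norm_real x : `|(x%:C)%C : C| = (`|x|%:C)%C.
Proof. by rewrite normc_def /= expr0n addr0 sqrtr_sqr. Qed.

Lemma norm_complexE z : `|z| = (Num.sqrt (complex.Re z ^+ 2 + complex.Im z ^+ 2))%:C%C.
Proof. exact: normc_def. Qed.

Lemma cvg_real (T : Type) (F : set_system T) (FF : Filter F) (f : T -> R) x :
  f @ F --> x -> (fun s => (f s)%:C%C : C) @ F --> ((x%:C)%C : C).
Proof.
move=> fx; apply/cvgrPdist_lt => e; rewrite ltcE => /andP[/= /eqP ei er].
have /cvgrPdist_lt /(_ _ er) := fx.
apply: filterS => t.
by rewrite -rmorphB norm_real ltcE /= ei eqxx.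
Qed.

Lemma cvg_complex (T : Type) (F : set_system T) (FF : Filter F) (f g : T -> R) x y :
  f @ F --> x -> g @ F --> y ->
  (fun s => (f s +i* g s)%C : C) @ F --> ((x +i* y)%C : C).
Proof.
move=> fx gy.
have E (u v : R) : ((u +i* v)%C : C) = (u%:C)%C + ('i%C : C) * (v%:C)%C.
  exact: complexE.
rewrite E; under eq_fun do rewrite E.
apply: cvgD; first exact: cvg_real.
by apply: cvgM; [exact: cvg_cst|exact: cvg_real].
Qed.

Lemma norm_Re_le z : (`|complex.Re z|%:C)%C <= `|z|.
Proof. exact: normc_ge_Re. Qed.

Lemma norm_Im_le z : (`|complex.Im z|%:C)%C <= `|z|.
Proof.
rewrite norm_complexE lecR -[leLHS]sqrtr_sqr ler_wsqrtr //.
by rewrite lerDr sqr_ge0.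
Qed.

Lemma cvg_Re (T : Type) (F : set_system T) (FF : Filter F) (f : T -> C) z :
  f @ F --> z -> (fun s => complex.Re (f s)) @ F --> complex.Re z.
Proof.
move=> fz; apply/cvgrPdist_lt => e e0.
have e0' : 0 < ((e%:C)%C : C) by rewrite ltcR.
have /cvgrPdist_lt/(_ _ e0') := fz.
apply: filterS => s; rewrite -ltcR -raddfB /=; apply: le_lt_trans.
exact: norm_Re_le.
Qed.

Lemma cvg_Im (T : Type) (F : set_system T) (FF : Filter F) (f : T -> C) z :
  f @ F --> z -> (fun s => complex.Im (f s)) @ F --> complex.Im z.
Proof.
move=> fz; apply/cvgrPdist_lt => e e0.
have e0' : 0 < ((e%:C)%C : C) by rewrite ltcR.
have /cvgrPdist_lt/(_ _ e0') := fz.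
apply: filterS => s; rewrite -ltcR -raddfB /=; apply: le_lt_trans.
exact: norm_Im_le.
Qed.

Lemma cvg_conj (T : Type) (F : set_system T) (FF : Filter F) (f : T -> C) z :
  f @ F --> z -> (fun s => (f s)^*) @ F --> z^*.
Proof.
move=> fz; apply/cvgrPdist_lt => e e0.
have /cvgrPdist_lt/(_ _ e0) := fz.
by apply: filterS => s; rewrite -rmorphB norm_conjC.
Qed.

Lemma continuous_cis : continuous cis.
Proof.
by move=> t; apply: cvg_complex; [exact: continuous_cos|exact: continuous_sin].
Qed.

Lemma cis_surjective z : `|z| = 1 -> exists t, z = cis t.
Proof.
case: z => x y /(congr1 (fun z => z ^+ 2)); rewrite /= expr1n -add_Re2_Im2 /=.
move=> /(congr1 (@complex.Re _)) /= e.
have x1 : -1 <= x <= 1.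
  by rewrite -ler_norml -(@expr_le1 _ 2) // real_normK ?num_real //; nra.
have [y0|y0] := leP 0 y.
  exists (acos x); rewrite /cis acosK ?in_itv //= sin_acos //.
  by rewrite -e [_ - _]addrAC subrr add0r sqrtr_sqr ger0_norm.
exists (- acos x); rewrite /cis cosN sinN acosK ?in_itv //= sin_acos //.
by rewrite -e [_ - _]addrAC subrr add0r sqrtr_sqr ltr0_norm // opprK.
Qed.

(** The argument of a number in the right half-plane. *)
Definition half_arg z : R := atan (complex.Im z / complex.Re z).

Lemma half_argP z : 0 < complex.Re z -> z = `|z| * cis (half_arg z).
Proof.
case: z => x y /= x0; rewrite norm_complexE /= /cis /half_arg cos_atan /=.
have c0 : cos (atan (y / x)) != 0.
  by rewrite cos_atan invr_eq0 sqrtr_eq0 -ltNge ltr_pwDl // sqr_ge0.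
have -> : sin (atan (y / x)) = cos (atan (y / x)) * (y / x).
  have /(canRL (divfK c0)) -> : sin (atan (y / x)) / cos (atan (y / x)) = y / x.
    exact: atanK.
  by rewrite mulrC.
rewrite cos_atan.
have -> : 1 + (y / x) ^+ 2 = (x ^+ 2 + y ^+ 2) / x ^+ 2 by field; rewrite gt_eqF.
rewrite sqrtrM ?addr_ge0 ?sqr_ge0 // sqrtrV ?sqr_ge0 // sqrtr_sqr gtr0_norm //.
set s := Num.sqrt _; have s0 : 0 < s.
  by rewrite sqrtr_gt0 ltr_wpDr ?sqr_ge0 // exprn_gt0.
by apply/eqP; rewrite eq_complex /=; apply/andP; split; apply/eqP; field; rewrite !gt_eqF.
Qed.

Lemma cvg_half_arg (T : Type) (F : set_system T) (FF : Filter F) (f : T -> C) z :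
  0 < complex.Re z -> f @ F --> z -> (fun s => half_arg (f s)) @ F --> half_arg z.
Proof.
move=> z0 fz.
apply: (cvg_comp _ (@atan R)); last exact: continuous_atan.
apply: cvgM; first exact: cvg_Im.
by apply: cvgV; [rewrite gt_eqF|exact: cvg_Re].
Qed.

End ComplexNumbers.

(** * Paths on the unit interval *)

Lemma continuous_pair (S T U : topologicalType) (f : S -> T) (g : S -> U) x :
  {for x, continuous f} -> {for x, continuous g} ->
  {for x, continuous (fun s => (f s, g s))}.
Proof. by move=> cf cg; exact: (cvg_pair cf cg). Qed.

Section Clamp.
Context {R : realType}.
Implicit Types (t u : R).

(** A retraction of the line onto [0, 1]: composing with it turns continuity on
    the interval into continuity everywhere. *)
Definition clamp t : R := Num.max 0 (Num.min 1 t).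

Lemma clamp_itv t : 0 <= clamp t <= 1.
Proof. by rewrite /clamp le_max lexx /= ge_max ler01 ge_min lexx. Qed.

Lemma clamp_id t : 0 <= t <= 1 -> clamp t = t.
Proof. by move=> /andP[t0 t1]; rewrite /clamp (min_idPr t1) (max_idPr t0). Qed.

Lemma clamp0 : clamp 0 = 0.
Proof. by rewrite clamp_id ?lexx ?ler01. Qed.

Lemma clamp1 : clamp 1 = 1.
Proof. by rewrite clamp_id ?lexx ?ler01. Qed.

Lemma continuous_clamp : continuous clamp.
Proof.
move=> t.
have cmin : {for t, continuous (fun s : R => Num.min 1 s : R^o)}.
  refine (@continuous_min R R (cst 1) id t (@cst_continuous R R 1 t) cvg_id).
refine (@continuous_max R R (cst 0) _ t (@cst_continuous R R 0 t) cmin).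
Qed.

Lemma continuous_retract (S T U : topologicalType) (A : set T) (r : S -> T)
    (f : T -> U) :
  continuous r -> (forall s, A (r s)) -> {within A, continuous f} ->
  continuous (f \o r).
Proof.
move=> cr Ar /subspace_continuousP cf s W fW.
have := cr s _ (cf (r s) (Ar s) _ fW).
apply: (@filterS _ (nbhs s)) => x /= h; exact: h (Ar x).
Qed.

Lemma within_eq_continuous (T U : topologicalType) (A : set T) (f g : T -> U) :
  (forall x, A x -> f x = g x) -> continuous f -> {within A, continuous g}.
Proof.
move=> fg cf; apply: (@subspace_eq_continuous _ _ _ f).
  by move=> x; rewrite inE; exact: fg.
exact: continuous_subspaceT.
Qed.

Lemma continuous_clamp_path (T : topologicalType) (a : R -> T) :
  {within `[0, 1], continuous a} -> continuous (a \o clamp).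
Proof.
move=> ca; apply: continuous_retract ca; first exact: continuous_clamp.
by move=> t /=; rewrite in_itv clamp_itv.
Qed.

Lemma continuous_clamp_square (T : topologicalType) (H : R * R -> T) :
  {within `[0, 1] `*` `[0, 1], continuous H} ->
  continuous (fun x : R * R => H (clamp x.1, clamp x.2)).
Proof.
apply: (@continuous_retract _ _ _ _ (fun x : R * R => (clamp x.1, clamp x.2))).
  move=> x; apply: (@continuous_pair _ R R (fun x : R * R => clamp x.1)
    (fun x : R * R => clamp x.2)).
    by apply: continuous_comp; [exact: cvg_fst|exact: continuous_clamp].
  by apply: continuous_comp; [exact: cvg_snd|exact: continuous_clamp].
by move=> x; split; rewrite /= in_itv clamp_itv.
Qed.

End Clamp.

(** * Lifting paths and homotopies from the circle to the line *)

Section Lifting.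
Context {R : realType}.
Local Notation C := (Cplx R).
Implicit Types (t u : R) (z w : C) (th : R -> R) (k : int).

Lemma cis_pi : cis pi = -1 :> C.
Proof.
by rewrite /cis cospi sinpi; apply/eqP; rewrite eq_complex /= eqxx oppr0 /=.
Qed.

Lemma cis_2pi k : cis (2 * pi * k%:~R) = 1 :> C.
Proof.
have nat_case (n : nat) : cis (2 * pi * n%:R) = 1 :> C.
  elim: n => [|n IH]; first by rewrite mulr0 cis0.
  rewrite -(natr1 n) mulrDr cisD IH mul1r mulr1.
  by rewrite mulr_natl mulr2n cisD cis_pi mulrNN mulr1.
case: k => n; first exact: nat_case.
rewrite NegzE rmorphN /= mulrN -conj_cis.
by rewrite (nat_case n.+1) conjC1.
Qed.

Lemma cis_eq1 t : cis t = 1 :> C -> exists k, t = 2 * pi * k%:~R.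
Proof.
move=> t1; have pi0 := @pi_gt0 R.
exists (Num.floor (t / (2 * pi))); set k := Num.floor _.
pose r := t - 2 * pi * k%:~R.
have r1 : cis r = 1 :> C by rewrite cisD t1 mul1r -conj_cis cis_2pi conjC1.
have r0 : 0 <= r.
  rewrite subr_ge0 mulrC -ler_pdivlMr ?mulr_gt0 //.
  exact: floor_le_tmp.
have r2 : r < 2 * pi.
  rewrite ltrBlDr -[X in X + _]mulr1 -mulrDr [2 * pi * _]mulrC -ltr_pdivrMr ?mulr_gt0 //.
  by rewrite addrC -intrD1 floorD1_gt.
apply/eqP; rewrite -subr_eq0 -/r eq_le r0 andbT leNgt; apply/negP => rgt.
have s0 : 0 < sin (r / 2) by rewrite sin_gt0_pi //; apply/andP; split; lra.
have : cos r = 1 by case: r1.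
have -> : r = r / 2 + r / 2 by field.
rewrite cosD; have := cos2Dsin2 (r / 2); nra.
Qed.

(** A continuous function with values in [2 pi Z] is constant on the interval:
    between two values it would take one with [cis] equal to -1. *)
Lemma lift_increment_unique th1 th2 :
  continuous th1 -> continuous th2 ->
  (forall t, 0 <= t <= 1 -> cis (th1 t) = cis (th2 t) :> C) ->
  th1 1 - th1 0 = th2 1 - th2 0.
Proof.
wlog le12 : th1 th2 / th1 0 - th2 0 <= th1 1 - th2 1.
  move=> W c1 c2 e; have [|/ltW] := leP (th1 0 - th2 0) (th1 1 - th2 1).
    by move=> le; apply: W.
  move=> le; apply/esym/W => //; first by lra.
  by move=> t /e.
move=> c1 c2 e; pose d t := th1 t - th2 t.
have cd : continuous d by move=> t; apply: cvgB; [exact: c1|exact: c2].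
have d1 t : 0 <= t <= 1 -> cis (d t) = 1 :> C.
  by move=> /e et; rewrite cisD et -conj_cis cis_mul_conj.
have [k dk] : exists k, d 0 = 2 * pi * k%:~R.
  by apply: cis_eq1; apply: d1; rewrite lexx ler01.
have [l dl] : exists k, d 1 = 2 * pi * k%:~R.
  by apply: cis_eq1; apply: d1; rewrite lexx ler01.
have pi0 := @pi_gt0 R.
have le : d 0 <= d 1 by [].
have [kl|kl|kl] := ltgtP k l; last first.
- by move: dk dl; rewrite kl /d; lra.
- move: le; rewrite dk dl ler_pM2l ?mulr_gt0 // ler_int; lia.
have {}kl : k%:~R + 1 <= l%:~R :> R by rewrite -intrD1 ler_int; lia.
have [||t] := @IVT R d 0 1 (d 0 + pi) ler01.
- exact: continuous_subspaceT.
- rewrite (min_idPl le) (max_idPr le); apply/andP; split; first by lra.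
  by rewrite dk dl; nra.
rewrite in_itv /= => /d1 + dt; rewrite dt cisD d1 ?lexx ?ler01 // mul1r cis_pi.
by move/eqP; rewrite -subr_eq0 -opprD oppr_eq0 -(natrD _ 1 1) pnatr_eq0.
Qed.

(** For [a], [b] of modulus 1 with [|a - b| < 1] the quotient [b / a] lies in the
    right half-plane, where the argument is continuous; the correction is the same at both ends of a closed
    loop. *)
Lemma lift_step (a b : R -> C) th :
  continuous a -> continuous b ->
  (forall t, `|a t| = 1) -> (forall t, `|b t| = 1) ->
  (forall t, `|a t - b t| < 1) ->
  continuous th -> (forall t, a t = cis (th t)) ->
  exists2 th', continuous th' &
    (forall t, b t = cis (th' t)) /\
    (a 0 = a 1 -> b 0 = b 1 -> th' 1 - th' 0 = th 1 - th 0).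
Proof.
move=> ca cb a1 b1 ab cth ath.
pose q t : C := b t * (a t)^*.
have q1 t : `|q t| = 1 by rewrite normrM norm_conjC a1 b1 mulr1.
have qre t : 0 < complex.Re (q t).
  have : `|1 - q t| < 1.
    by rewrite -{1}(norm1_mul_conj (a1 t)) -mulrBl normrM norm_conjC a1 mulr1.
  move=> /(le_lt_trans (norm_Re_le _)); rewrite ltcR raddfB /=.
  by move=> /(le_lt_trans (ler_norm _)); lra.
exists (fun t => th t + half_arg (q t)).
  move=> t; apply: cvgD; first exact: cth.
  apply: (@cvg_half_arg _ _ _ _ q) => //.
  by apply: cvgM; [exact: cb|apply: (@cvg_conj _ _ _ _ a); exact: ca].
split=> [t|a01 b01]; last by rewrite /q a01 b01; lra.
have := half_argP (qre t); rewrite q1 mul1r cisD => <-.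
by rewrite -ath /q mulrCA norm1_mul_conj // mulr1.
Qed.

(** Compactness of the square makes [G] uniformly continuous. *)
Lemma homotopy_uniform (G : R * R -> C) :
  continuous G -> exists N : nat, forall u u' t,
    0 <= u <= 1 -> 0 <= t <= 1 -> `|u - u'| <= N.+1%:R^-1 ->
    `|G (u, t) - G (u', t)| < 1.
Proof.
move=> cG; have /compact_near_coveringP :=
  compact_setX (@segment_compact R 0 1) (@segment_compact R 0 1).
pose P (N : nat) (x : R * R) := forall u', `|x.1 - u'| <= N.+1%:R^-1 ->
  `|G x - G (u', x.2)| < 1.
move=> /(_ nat \oo P _) [].
  move=> x0 _.
  have h0 : 0 < 2^-1 :> C by rewrite invr_gt0.
  have /cvgrPdist_lt/(_ _ h0) := cG x0.
  move=> /nbhs_ballP[e /= e0 Ge].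
  have e2 : 0 < e / 2 by rewrite divr_gt0.
  have [N Ne] : exists N : nat, forall m, (N <= m)%N -> m.+1%:R^-1 < e / 2.
    have [N] := ltr_add_invr e2; rewrite add0r => HN.
    exists N => m Nm; apply: le_lt_trans HN.
    by rewrite lef_pV2 ?posrE ?ltr0n // ler_nat ltnS.
  exists (ball x0 (e / 2), [set m | (N <= m)%N]).
    by split; [exact: nbhsx_ballx|exists N].
  move=> [x m] /= [xb Nm] u' xu'.
  have Gx : `|G x0 - G x| < 2^-1.
    by apply: Ge; apply: le_ball xb; lra.
  have Gx' : `|G x0 - G (u', x.2)| < 2^-1.
    apply: Ge; case: x xb xu' {Gx} => u t /= [] /= ub tb uu'.
    split=> /=; last by apply: le_ball tb; lra.
    rewrite /ball /=; rewrite /ball /= in ub.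
    rewrite (_ : x0.1 - u' = (x0.1 - u) + (u - u')); last by ring.
    apply: (le_lt_trans (ler_normD _ _)); rewrite (splitr e) ltrD //.
    exact: le_lt_trans uu' (Ne _ Nm).
  rewrite (_ : G x - _ = (G x0 - G (u', x.2)) - (G x0 - G x)); last by ring.
  apply: (le_lt_trans (ler_normB _ _)).
  by rewrite (splitr 1) ltrD // mul1r.
move=> N _ HN; exists N => u u' t hu ht uu'.
have := HN N (leqnn N) (u, t) _ u' uu'; apply.
by split; rewrite /= in_itv.
Qed.

(** Covering homotopy: the parameter [u] moves in steps so small that a lift at
    one end of a step is corrected to a lift at the other end by angles in the
    right half-plane. *)
Lemma homotopy_lift (H : R * R -> C) th :
  {within `[0, 1] `*` `[0, 1], continuous H} ->
  (forall u t, 0 <= u <= 1 -> 0 <= t <= 1 -> `|H (u, t)| = 1) ->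
  continuous th -> (forall t, H (0, clamp t) = cis (th t)) ->
  exists2 th', continuous th' &
    (forall t, H (1, clamp t) = cis (th' t)) /\
    ((forall u, 0 <= u <= 1 -> H (u, 0) = H (u, 1)) ->
      th' 1 - th' 0 = th 1 - th 0).
Proof.
move=> cH H1 cth Hth; pose G x := H (clamp x.1, clamp x.2).
have cG : continuous G by exact: continuous_clamp_square.
have [N GN] := homotopy_uniform cG.
have cGu u : continuous (fun t => G (u, t)).
  move=> t; apply: (@continuous_comp _ _ _ (fun t => (u, t)) G); last exact: cG.
  by apply: continuous_pair; [exact: cvg_cst|exact: cvg_id].
have G1 x : `|G x| = 1 by apply: H1; exact: clamp_itv.
suff /(_ N.+1 (leqnn _)) : forall k : nat, (k <= N.+1)%N -> exists2 th', continuous th' &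
    (forall t, G (k%:R / N.+1%:R, t) = cis (th' t)) /\
    ((forall u, 0 <= u <= 1 -> H (u, 0) = H (u, 1)) ->
      th' 1 - th' 0 = th 1 - th 0).
  rewrite divff ?pnatr_eq0 // => -[th' c' [l' i']]; exists th' => //.
  by split=> // t; rewrite -l' /G /= clamp1.
elim=> [|k IH] kN.
  by exists th => //; split=> // t; rewrite mul0r /G /= clamp0 Hth.
have [th1 c1 [l1 i1]] := IH (ltnW kN).
have [|||||||th2 c2 [l2 i2]] := @lift_step (fun t => G (k%:R / N.+1%:R, t))
  (fun t => G (k.+1%:R / N.+1%:R, t)) th1 => //.
  move=> t.
  have := GN (k%:R / N.+1%:R) (k.+1%:R / N.+1%:R) (clamp t).
  rewrite /G /= (clamp_id (clamp_itv t)); apply; last 2 first.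
  - exact: clamp_itv.
  - rewrite -mulrBl -[k.+1]addn1 natrD opprD addNKr mulN1r normrN.
    by rewrite ger0_norm // invr_ge0.
  by rewrite divr_ge0 //= ler_pdivrMr // mul1r ler_nat ltnW.
exists th2 => //; split=> // H01; rewrite i2 ?i1 //.
  by rewrite /G /= clamp0 clamp1 H01 // clamp_itv.
by rewrite /G /= clamp0 clamp1 H01 // clamp_itv.
Qed.

(** A path [a] is the end of the homotopy [(u, t) |-> a (u t)], which starts at
    a constant. *)
Lemma path_lift (a : R -> C) :
  {within `[0, 1], continuous a} -> (forall t, 0 <= t <= 1 -> `|a t| = 1) ->
  exists2 th, continuous th & forall t, a (clamp t) = cis (th t).
Proof.
move=> ca a1.
have [t0 at0] : exists t0, a 0 = cis t0.
  by apply: cis_surjective; rewrite a1 // lexx ler01.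
pose H (x : R * R) := (a \o clamp) (x.1 * x.2).
have [||||th cth [ath _]] := @homotopy_lift H (cst t0).
- apply: continuous_subspaceT => x.
  apply: (@continuous_comp _ _ _ (fun x : R * R => x.1 * x.2) (a \o clamp)).
    by apply: cvgM; [exact: cvg_fst|exact: cvg_snd].
  exact: continuous_clamp_path.
- by move=> u t _ _; apply: a1; exact: clamp_itv.
- exact: cst_continuous.
- by move=> t; rewrite /H /= mul0r clamp0 at0.
exists th => // t; rewrite -ath /H /= mul1r; congr a.
by rewrite [RHS]clamp_id // clamp_itv.
Qed.

End Lifting.

(** * Winding numbers *)

Section Winding.
Context {R : realType}.
Local Notation C := (Cplx R).
Implicit Types (t u : R) (th : R -> R) (k l : int).

Definition is_lift (a : R -> C) th : Prop :=
  continuous th /\ forall t, 0 <= t <= 1 -> a t = cis (th t).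

(** The value 0 is a default for maps without such a lift; continuous
    loops in the circle all have one. *)
Definition winding (a : R -> C) : int :=
  xget 0 [set k | exists2 th, is_lift a th & th 1 - th 0 = 2 * pi * k%:~R].

Lemma mul_2pi_inj k l : 2 * pi * k%:~R = 2 * pi * l%:~R :> R -> k = l.
Proof.
have p0 : 2 * pi != 0 :> R by rewrite mulf_neq0 ?pnatr_eq0 // gt_eqF // pi_gt0.
by move=> /(mulfI p0)/eqP; rewrite eqr_int => /eqP.
Qed.

Lemma is_lift_increment a th1 th2 : is_lift a th1 -> is_lift a th2 ->
  th1 1 - th1 0 = th2 1 - th2 0.
Proof.
move=> [c1 l1] [c2 l2]; apply: lift_increment_unique => // t ht.
by rewrite -l1 // l2.
Qed.

Lemma winding_def a th k : is_lift a th -> th 1 - th 0 = 2 * pi * k%:~R ->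
  winding a = k.
Proof.
move=> la hk; rewrite /winding; case: xgetP => [l _ [th' la' hl]|/(_ k)].
  apply: mul_2pi_inj; rewrite -hl -hk; exact: is_lift_increment la' la.
by case; exists th.
Qed.

Lemma windingP a th : is_lift a th -> a 0 = a 1 ->
  th 1 - th 0 = 2 * pi * (winding a)%:~R.
Proof.
move=> la a01; have [_ l] := la.
have [k hk] : exists k, th 1 - th 0 = 2 * pi * k%:~R.
  apply: (@cis_eq1 R); rewrite cisD -conj_cis -!l ?lexx ?ler01 // a01 l ?lexx ?ler01 //.
  by rewrite cis_mul_conj.
by rewrite (winding_def la hk).
Qed.

Lemma is_liftE a b th : is_lift a th -> (forall t, 0 <= t <= 1 -> a t = b t) ->
  is_lift b th.
Proof. by move=> [c l] ab; split=> // t ht; rewrite -ab // l. Qed.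

Lemma winding_homotopic (H : R * R -> C) :
  {within `[0, 1] `*` `[0, 1], continuous H} ->
  (forall u t, 0 <= u <= 1 -> 0 <= t <= 1 -> `|H (u, t)| = 1) ->
  (forall u, 0 <= u <= 1 -> H (u, 0) = H (u, 1)) ->
  winding (fun t => H (0, t)) = winding (fun t => H (1, t)).
Proof.
move=> cH H1 H01.
have itv0 : 0 <= (0 : R) <= 1 by rewrite lexx ler01.
have itv1 : 0 <= (1 : R) <= 1 by rewrite lexx ler01.
have cH0 : {within `[0, 1], continuous (fun t => H (0, t))}.
  apply: (@within_eq_continuous _ _ _ (fun t => H (clamp 0, clamp t))) => [t|].
    by rewrite /= in_itv /= => ht; rewrite !clamp_id.
  move=> t; apply: (@continuous_comp _ _ _ (fun t => (0, t))
    (fun x : R * R => H (clamp x.1, clamp x.2))).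
    by apply: continuous_pair; [exact: cvg_cst|exact: cvg_id].
  exact: continuous_clamp_square.
have [th cth Hth] := path_lift cH0 (fun t => H1 0 t itv0).
have [th' cth' [Hth' inc]] := homotopy_lift cH H1 cth Hth.
have l0 : is_lift (fun t => H (0, t)) th.
  by split=> // t ht; rewrite -Hth clamp_id.
have l1 : is_lift (fun t => H (1, t)) th'.
  by split=> // t ht; rewrite -Hth' clamp_id.
by apply: (winding_def l0); rewrite -(windingP l1) ?H01 // inc.
Qed.

End Winding.

(** * The fundamental group of the distinguished boundary *)

Section FundamentalGroupOfbGamma.
Context {R : realType}.
Local Notation C := (Cplx R).
Local Notation bG := (@bGamma R).
Implicit Types (t u : R) (th x : R -> R) (k : int) (a b : R -> C * C).

(** The Moebius band: the point of [bGamma] at angle [th] and height [x]. *)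
Definition band (x th : R) : C * C := ((x%:C)%C * cis (th / 2), cis th).

Lemma bGamma_band (x th : R) : `|x| <= 2 -> bG (band x th).
Proof.
move=> x2; split=> /=.
- rewrite normrM norm_cis mulr1 norm_real.
  by rewrite (_ : 2 = (2%:C)%C :> C) ?lecR // -[2%R]/(2%:R) rmorph_nat.
- exact: norm_cis.
- rewrite rmorphM /= real_conj conj_cis -mulrA -cisD.
  by congr (_ * cis _); field.
Qed.

(** The real coordinate [x] of [s = x cis (th / 2)]. *)
Definition height (s : C) (th : R) : R := complex.Re (s * cis (- (th / 2))).

Lemma bGammaE (s : C) (th : R) : bG (s, cis th) -> (s, cis th) = band (height s th) th.
Proof.
move=> [/= _ _ e]; rewrite /band /height; congr (_, _).
set r := s * _; have rr : r^* = r.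
  rewrite /r {2}e rmorphM /= conj_cis opprK -mulrA -cisD.
  by congr (_ * cis _); field.
have -> : ((complex.Re r)%:C)%C = r.
  by rewrite RRe_real //; apply/CrealP; exact: rr.
by rewrite /r -mulrA -cisD addNr cis0 mulr1.
Qed.

Lemma height_le2 (s : C) (th : R) : bG (s, cis th) -> `|height s th| <= 2.
Proof.
move=> [/= s2 _ _]; rewrite -lecR.
apply: (le_trans (norm_Re_le _)); rewrite normrM norm_cis mulr1.
by apply: (le_trans s2); rewrite -[2%R in X in _ <= X]/(2%:R) rmorph_nat.
Qed.

Lemma continuous_band (T : topologicalType) (f g : T -> R) :
  continuous f -> continuous g -> continuous (fun y => band (f y) (g y)).
Proof.
move=> cf cg y; rewrite /band.
apply: (@continuous_pair _ C C (fun y => ((f y)%:C)%C * cis (g y / 2))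
  (fun y => cis (g y))).
  apply: cvgM; first by apply: cvg_real; exact: cf.
  apply: (@continuous_comp _ _ _ (fun y => g y / 2) (@cis R)); last exact: continuous_cis.
  by apply: cvgM; [exact: cg|exact: cvg_cst].
by apply: continuous_comp; [exact: cg|exact: continuous_cis].
Qed.

(** The angle is lifted first and then determines the height. Prescribing the
    initial angle lets two loops with the same base point be compared. *)
Lemma loop_coordinates p a (th0 : R) : p.2 = cis th0 -> is_loop bG p a ->
  exists x th, [/\ continuous x, continuous th, th 0 = th0,
    forall t, a (clamp t) = band (x t) (th t) & forall t, `|x t| <= 2].
Proof.
move=> pth [ca a0 a1 aA].
have ca' := continuous_clamp_path ca.
have cs : continuous (fun t => (a (clamp t)).1).
  by move=> t; apply: (@continuous_comp _ _ _ (a \o clamp) fst); [exact: ca'|exact: cvg_fst].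
have cp : continuous (fun t => (a (clamp t)).2).
  by move=> t; apply: (@continuous_comp _ _ _ (a \o clamp) snd); [exact: ca'|exact: cvg_snd].
have [||ph cph aph] := @path_lift R (fun t => (a t).2).
- apply: (within_eq_continuous _ cp) => t.
  by rewrite /= in_itv /= => ht; rewrite clamp_id.
- by move=> t /aA[].
pose th t := ph t + (th0 - ph 0).
have cth : continuous th by move=> t; apply: cvgD; [exact: cph|exact: cvg_cst].
have ath t : (a (clamp t)).2 = cis (th t).
  have p0 : cis (ph 0) = cis th0 :> C by rewrite -aph clamp0 a0 pth.
  by rewrite aph /th !cisD -conj_cis p0 cis_mul_conj mulr1.
have bth t : bG ((a (clamp t)).1, cis (th t)).
  by rewrite -ath -surjective_pairing; apply: aA; exact: clamp_itv.
exists (fun t => height (a (clamp t)).1 (th t)), th; split=> //.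
- move=> t; apply: cvg_Re; apply: cvgM; first exact: cs.
  apply: (@continuous_comp _ _ _ (fun t => - (th t / 2)) (@cis R)); last exact: continuous_cis.
  by apply: cvgN; apply: cvgM; [exact: cth|exact: cvg_cst].
- by rewrite /th; lra.
- by move=> t; rewrite -bGammaE // -ath -surjective_pairing.
- by move=> t; exact: height_le2.
Qed.

Definition bwinding a : int := winding (fun t => (a t).2).

Lemma band_lift a x th : continuous th ->
  (forall t, 0 <= t <= 1 -> a t = band (x t) (th t)) ->
  is_lift (fun t => (a t).2) th.
Proof. by move=> cth e; split=> // t ht; rewrite e. Qed.

Lemma band_inj (x y th : R) : band x th = band y th -> x = y.
Proof.
move=> /(congr1 fst) /= e.
by apply: complexI; apply: (mulIf (cis_neq0 (th / 2))).
Qed.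

Lemma bGamma_angle p : bG p -> exists th0 : R, p.2 = cis th0.
Proof. by case=> _ p1 _; exact: cis_surjective. Qed.

Lemma band_loop p x th : continuous x -> continuous th ->
  (forall t, `|x t| <= 2) -> band (x 0) (th 0) = p -> band (x 1) (th 1) = p ->
  is_loop bG p (fun t => band (x t) (th t)).
Proof.
move=> cx cth x2 p0 p1; split=> //; last by move=> t _; exact: bGamma_band.
by apply: continuous_subspaceT; exact: continuous_band.
Qed.

(** In the coordinates (height, angle) a straight-line homotopy joins two loops
    with the same winding number. *)
Lemma bwinding_eq_homotopic p a b : bG p -> is_loop bG p a -> is_loop bG p b ->
  bwinding a = bwinding b -> loop_homotopic bG p a b.
Proof.
move=> /bGamma_angle[th0 pth] la lb wab.
have i0 : 0 <= (0 : R) <= 1 by rewrite lexx ler01.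
have i1 : 0 <= (1 : R) <= 1 by rewrite lexx ler01.
have [x [th [cx cth th00 axt x2]]] := loop_coordinates pth la.
have [y [ph [cy cph ph00 byp y2]]] := loop_coordinates pth lb.
have {}axt t : 0 <= t <= 1 -> a t = band (x t) (th t).
  by move=> ht; rewrite -axt clamp_id.
have {}byp t : 0 <= t <= 1 -> b t = band (y t) (ph t).
  by move=> ht; rewrite -byp clamp_id.
have [_ a0 a1 _] := la; have [_ b0 b1 _] := lb.
have lth := band_lift cth axt; have lph := band_lift cph byp.
have wth := windingP lth; have wph := windingP lph.
rewrite a0 a1 b0 b1 in wth wph; have {}wth := wth erefl; have {}wph := wph erefl.
rewrite -/(bwinding a) wab -wph th00 ph00 in wth.
have th1 : th 1 = ph 1 by apply: addIr wth.
have x0 : x 0 = y 0.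
  by apply: (@band_inj _ _ th0); rewrite -{1}th00 -{1}ph00 -axt // -byp // a0.
have x1 : x 1 = y 1.
  by apply: (@band_inj _ _ (th 1)); rewrite {2}th1 -axt // -byp // a1.
pose mix (f g : R -> R) (v : R * R) := (1 - v.1) * f v.2 + v.1 * g v.2.
have cmix (f g : R -> R) : continuous f -> continuous g -> continuous (mix f g).
  move=> cf cg v.
  have cf2 : {for v, continuous (fun v : R * R => f v.2)}.
    by apply: continuous_comp; [exact: cvg_snd|exact: cf].
  have cg2 : {for v, continuous (fun v : R * R => g v.2)}.
    by apply: continuous_comp; [exact: cvg_snd|exact: cg].
  apply: cvgD; apply: cvgM; [|exact: cf2|exact: cvg_fst|exact: cg2].
  by apply: cvgB; [exact: cvg_cst|exact: cvg_fst].
have cmixu (f g : R -> R) u : continuous f -> continuous g ->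
    continuous (fun t => mix f g (u, t)).
  move=> cf cg t; apply: (@continuous_comp _ _ _ (fun t => (u, t)) (mix f g)).
    by apply: continuous_pair; [exact: cvg_cst|exact: cvg_id].
  exact: cmix.
have mixE (f g : R -> R) u t : f t = g t -> mix f g (u, t) = f t.
  by move=> e; rewrite /mix /= e; ring.
exists (fun v => band (mix x y v) (mix th ph v)); split.
- by apply: continuous_subspaceT; apply: continuous_band; exact: cmix.
- move=> t ht; rewrite /mix /= subr0 subrr !mul1r !mul0r !addr0 !add0r.
  by rewrite axt // byp.
- move=> u /andP[u0 u1].
  apply: (@band_loop _ (fun t => mix x y (u, t)) (fun t => mix th ph (u, t))).
  + exact: cmixu.
  + exact: cmixu.
  + move=> t; rewrite /mix /=; apply: (le_trans (ler_normD _ _)).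
    rewrite !normrM [`|1 - u|]ger0_norm ?subr_ge0 // [`|u|]ger0_norm //.
    rewrite (_ : 2 = (1 - u) * 2 + u * 2); last by ring.
    apply: lerD; apply: ler_wpM2l => //; rewrite subr_ge0 ?u1 //.
  +
    by rewrite (mixE x y) // (mixE th ph) -?axt // th00 ph00.
  +
    by rewrite (mixE x y) // (mixE th ph) -?axt.
Qed.

Lemma homotopic_bwinding_eq p a b : loop_homotopic bG p a b ->
  bwinding a = bwinding b.
Proof.
move=> [H [cH Hab Hl]].
have cH' := continuous_clamp_square cH.
pose G (v : R * R) := (H v).2.
have cG : {within `[0, 1] `*` `[0, 1], continuous G}.
  apply: (@within_eq_continuous _ _ _ (fun v : R * R => (H (clamp v.1, clamp v.2)).2)).
    by move=> [u t] [/=]; rewrite !in_itv /= => hu ht; rewrite /G !clamp_id.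
  move=> v; apply: (@continuous_comp _ _ _ (fun v : R * R => H (clamp v.1, clamp v.2)) snd).
    exact: cH'.
  exact: cvg_snd.
have := winding_homotopic cG; rewrite /G => W.
have e c d : (forall t, 0 <= t <= 1 -> c t = d t :> C) -> winding c = winding d.
  move=> cd; rewrite /winding; congr (xget _ _); apply/seteqP; split=> k [th lth hk].
    by exists th => //; apply: is_liftE lth _.
  by exists th => //; apply: is_liftE lth _ => t ht; rewrite cd.
transitivity (winding (fun t => (H (0, t)).2)).
  by apply: e => t ht; rewrite (Hab t ht).1.
rewrite W; last 2 first.
- by move=> u t /Hl[_ _ _ h] /h[].
- by move=> u /Hl[_ -> -> _].
by apply: e => t ht; rewrite (Hab t ht).2.
Qed.

Lemma loop_mulP p a b : is_loop bG p a -> is_loop bG p b ->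
  is_loop bG p (loop_mul a b).
Proof.
move=> [ca a0 a1 aA] [cb b0 b1 bA].
have half : 2 * 2^-1 = 1 :> R by field.
split.
- have -> : [set` `[0 : R, 1]] = [set` `[0 : R, 2^-1]] `|` [set` `[2^-1 : R, 1]].
    apply/seteqP; split=> t /=; rewrite !in_itv /=.
      by move=> /andP[t0 t1]; have [h|/ltW h] := leP t 2^-1; [left|right]; apply/andP.
    by case=> /andP[h1 h2]; apply/andP; split; lra.
  apply: withinU_continuous; try exact: interval_closed.
    apply: (@within_eq_continuous _ _ _ (fun t => a (clamp (2 * t)))) => [t|].
      rewrite /= in_itv /= => /andP[t0 th]; rewrite /loop_mul th clamp_id //.
      by apply/andP; split; lra.
    move=> t; apply: (@continuous_comp _ _ _ (fun t => 2 * t) (a \o clamp)).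
      by apply: cvgM; [exact: cvg_cst|exact: cvg_id].
    exact: continuous_clamp_path.
  apply: (@within_eq_continuous _ _ _ (fun t => b (clamp (2 * t - 1)))) => [t|].
    rewrite /= in_itv /= => /andP[th t1]; rewrite /loop_mul clamp_id; last first.
      by apply/andP; split; lra.
    case: ifP => // h; have -> : t = 2^-1 by apply/eqP; rewrite eq_le h th.
    by rewrite half subrr b0 a1.
  move=> t; apply: (@continuous_comp _ _ _ (fun t => 2 * t - 1) (b \o clamp)).
    apply: cvgB; last exact: cvg_cst.
    by apply: cvgM; [exact: cvg_cst|exact: cvg_id].
  exact: continuous_clamp_path.
- by rewrite /loop_mul invr_ge0 ler0n mulr0.
- rewrite /loop_mul mulr1 (_ : 2 - 1 = 1); last by ring.
  by case: ifP => //; rewrite leNgt invf_lt1 // ltr1n.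
- move=> t /andP[t0 t1]; rewrite /loop_mul; case: ifP => h.
    by apply: aA; apply/andP; split; lra.
  by apply: bA; apply/andP; split; move/negbT: h; rewrite -ltNge; lra.
Qed.

Lemma loop_lift p a : is_loop bG p a -> exists th, is_lift (fun t => (a t).2) th.
Proof.
move=> la; have [_ a0 _ aA] := la.
have [th0 pth] : exists th0 : R, p.2 = cis th0.
  by rewrite -a0; apply: bGamma_angle; apply: aA; rewrite lexx ler01.
have [x [th [_ cth _ axt _]]] := loop_coordinates pth la.
by exists th; apply: (@band_lift _ x _ cth) => t ht; rewrite -axt clamp_id.
Qed.

Lemma bwinding_mul p a b : is_loop bG p a -> is_loop bG p b ->
  bwinding (loop_mul a b) = bwinding a + bwinding b.
Proof.
move=> la lb.
have [th lth] := loop_lift la; have [ph lph] := loop_lift lb.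
have [_ a0 a1 _] := la; have [_ b0 b1 _] := lb.
have wth := windingP lth; have wph := windingP lph.
rewrite a0 a1 b0 b1 in wth wph; have {}wth := wth erefl; have {}wph := wph erefl.
have [cth ath] := lth; have [cph bph] := lph.
have i0 : 0 <= (0 : R) <= 1 by rewrite lexx ler01.
have i1 : 0 <= (1 : R) <= 1 by rewrite lexx ler01.
(* One clamped factor is constant on each half. *)
pose ps t := th (clamp (2 * t)) + (ph (clamp (2 * t - 1)) - ph 0).
have clamp_ge1 t : 1 <= t -> clamp t = 1.
  by move=> t1; rewrite /clamp (min_idPl t1) (max_idPr ler01).
have clamp_le0 t : t <= 0 -> clamp t = 0.
  move=> t0; rewrite /clamp (min_idPr _) ?(max_idPl t0) //.
  exact: le_trans ler01.
apply: (@winding_def _ _ ps); last first.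
  rewrite /ps rmorphD /= mulrDr -wth -wph mulr0 mulr1 clamp0.
  rewrite (clamp_ge1 2) ?ler1n // (clamp_le0 (0 - 1)) ?sub0r ?oppr_le0 //.
  by rewrite (_ : 2 - 1 = 1) ?clamp1; ring.
split.
  move=> t; apply: cvgD.
    apply: (@continuous_comp _ _ _ (fun t => clamp (2 * t)) th); last exact: cth.
    apply: (@continuous_comp _ _ _ (fun t => 2 * t) clamp); last exact: continuous_clamp.
    by apply: cvgM; [exact: cvg_cst|exact: cvg_id].
  apply: cvgB; last exact: cvg_cst.
  apply: (@continuous_comp _ _ _ (fun t => clamp (2 * t - 1)) ph); last exact: cph.
  apply: (@continuous_comp _ _ _ (fun t => 2 * t - 1) clamp); last exact: continuous_clamp.
  apply: cvgB; last exact: cvg_cst.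
  by apply: cvgM; [exact: cvg_cst|exact: cvg_id].
move=> t /andP[t0 t1]; rewrite /loop_mul /ps; case: ifP => h.
  have ht : 0 <= 2 * t <= 1 by apply/andP; split; lra.
  rewrite ath // clamp_id // clamp_le0 ?subrr ?addr0 //; lra.
move/negbT: h; rewrite -ltNge => h.
have ht : 0 <= 2 * t - 1 <= 1 by apply/andP; split; lra.
rewrite bph // (clamp_id ht) clamp_ge1; last by lra.
have ab : cis (th 1) = cis (ph 0) :> C by rewrite -ath // -bph // a1 b0.
by rewrite !cisD -conj_cis ab mulrCA cis_mul_conj mulr1.
Qed.

(** The height must be reversed along a loop around the band when the winding
    number is odd. *)
Lemma bwinding_surjective p k : bG p ->
  exists2 a, is_loop bG p a & bwinding a = k.
Proof.
move=> bp; have [th0 pth] := bGamma_angle bp.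
case: p bp pth => s p /= bp pth; subst p.
pose x0 := height s th0; have x02 : `|x0| <= 2 by exact: height_le2.
pose e : R := (-1) ^+ `|k|%N.
have e1 : `|e| = 1 by rewrite normrX normrN1 expr1n.
pose x t := x0 * (1 - clamp t) + e * x0 * clamp t.
pose th t := th0 + 2 * pi * k%:~R * t.
have cx : continuous x.
  move=> t; apply: cvgD; apply: cvgM; try exact: cvg_cst; last exact: continuous_clamp.
  by apply: cvgB; [exact: cvg_cst|exact: continuous_clamp].
have cth : continuous th.
  by move=> t; apply: cvgD; [|apply: cvgM]; try exact: cvg_cst; exact: cvg_id.
have cis_pik : cis (pi * k%:~R) = (e%:C)%C :> C.
  have nat_case (n : nat) : cis (pi * n%:R) = (((-1) ^+ n)%:C)%C :> C.
    elim: n => [|n IH]; first by rewrite mulr0 cis0.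
    rewrite -(natr1 n) mulrDr cisD IH mulr1 cis_pi exprSr rmorphM /=.
    by rewrite rmorphN rmorph1.
  rewrite /e; case: (k) => n; first exact: nat_case.
  by rewrite NegzE rmorphN /= mulrN -conj_cis (nat_case n.+1) real_conj.
exists (fun t => band (x t) (th t)).
  apply: band_loop => //.
  - move=> t; rewrite /x; apply: (le_trans (ler_normD _ _)).
    have /andP[c0 c1] := clamp_itv t.
    rewrite !normrM e1 mul1r [`|clamp t|]ger0_norm // [`|1 - _|]ger0_norm ?subr_ge0 //.
    by rewrite -mulrDr subrK mulr1.
  - by rewrite /x /th clamp0 !mulr0 subr0 mulr1 !addr0 -bGammaE.
  - rewrite /x /th clamp1 subrr mulr0 add0r !mulr1 [RHS]bGammaE //.
    rewrite /band cisD cis_2pi mulr1 -/x0; congr (_, _).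
    rewrite (_ : (th0 + 2 * pi * k%:~R) / 2 = th0 / 2 + pi * k%:~R); last by field.
    rewrite cisD cis_pik rmorphM /=.
    have ee : (e%:C)%C * (e%:C)%C = 1 :> C.
      by rewrite -rmorphM /= -expr2 -real_normK ?num_real // e1 expr1n.
    by rewrite [cis _ * _]mulrC mulrACA ee mul1r.
apply: (@winding_def _ _ th); first by split.
by rewrite /th; ring.
Qed.

Lemma bwinding_iso p : bG p -> pi1_iso_int bG p bwinding.
Proof.
move=> bp; split=> [a b la lb|a b|k].
- by split; [exact: bwinding_eq_homotopic|exact: homotopic_bwinding_eq].
- exact: bwinding_mul.
- exact: bwinding_surjective.
Qed.

End FundamentalGroupOfbGamma.

(** An additive bijection of the integers is plus or minus the identity. *)
Lemma pi1_iso_int_unique (R : realType) (T : topologicalType) (A : set T) (p : T)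
    (phi psi : (R -> T) -> int) :
  (forall a b : R -> T, is_loop A p a -> is_loop A p b -> is_loop A p (loop_mul a b)) ->
  pi1_iso_int A p phi -> pi1_iso_int A p psi ->
  forall a, is_loop A p a -> `|phi a|%N = `|psi a|%N.
Proof.
move=> mulP [hphi mphi sphi] [hpsi mpsi spsi].
pose g (k : int) : R -> T := projT1 (cid2 (spsi k)).
have gl k : is_loop A p (g k) by rewrite /g; case: cid2.
have gk k : psi (g k) = k by rewrite /g; case: cid2.
have phig a : is_loop A p a -> phi a = phi (g (psi a)).
  by move=> la; apply/hphi => //; apply/hpsi => //; rewrite gk.
have fD k l : phi (g (k + l)) = phi (g k) + phi (g l).
  rewrite -mphi // [RHS]phig; last exact: mulP.
  by rewrite mpsi // !gk.
pose f k := phi (g k).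
have f0 : f 0 = 0 by have := fD 0 0; rewrite addr0 -/(f 0); lia.
have fnat (n : nat) : f n%:Z = n%:Z * f 1.
  elim: n => [|n IH]; first by rewrite mul0r.
  by rewrite -addn1 PoszD /f fD -/(f n%:Z) IH mulrDl mul1r.
have fN k : f (- k) = - f k.
  by have := fD k (- k); rewrite subrr -/(f 0) f0 -/(f k) -/(f (- k)); lia.
have fE k : f k = k * f 1.
  by case: k => n; rewrite ?NegzE ?fN fnat // mulNr.
have [a la] := sphi 1; rewrite phig // -/(f _) fE => f1.
move=> b lb; rewrite phig // -/(f _) fE abszM.
move/(congr1 absz): f1; rewrite abszM /= => /eqP.
by rewrite muln_eq1 => /andP[_ /eqP->]; rewrite muln1.
Qed.

(** * Winding number of a finite Blaschke product *)

Lemma cvg_horner (K : numFieldType) (T : Type) (F : set_system T) (FF : Filter F)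
    (f : T -> K) (z : K) (p : {poly K}) :
  f @ F --> z -> (fun s => p.[f s]) @ F --> p.[z].
Proof.
move=> fz; elim/poly_ind: p => [|p c IH].
  under eq_fun do rewrite horner0; rewrite horner0; exact: cvg_cst.
under eq_fun do rewrite hornerMXaddC.
rewrite hornerMXaddC; apply: cvgD; last exact: cvg_cst.
exact: (@cvgM _ _ _ FF (fun s => p.[f s]) f _ _ IH fz).
Qed.

Section Degree.
Context {R : realType}.
Local Notation C := (Cplx R).
Implicit Types (t u : R) (z w c : C) (k n : nat) (D : {poly C}).

Lemma closed_left_end (T : topologicalType) (A : set T) (f : R -> T) :
  closed A -> continuous f -> (forall t, 0 <= t < 1 -> A (f t)) -> A (f 1).
Proof.
move=> cA cf fA; apply: cA => B Bf.
have /nbhs_ballP[e /= e0 eB] := cf 1 B Bf.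
pose t := Num.max 0 (1 - e / 2).
have t1 : t < 1 by rewrite /t gt_max ltr01 /= ltrBlDr ltrDl divr_gt0.
have t0 : 0 <= t by rewrite le_max lexx.
exists (f t); split; first by apply: fA; rewrite t0.
apply: eB; rewrite /ball /= ger0_norm ?subr_ge0 ?ltW //.
have : 1 - e / 2 <= t by rewrite le_max lexx orbT.
by lra.
Qed.

(** Identities pass from the open disc to its boundary along radii. *)
Lemma eq_left_end (f g : R -> C) :
  continuous f -> continuous g -> (forall t, 0 <= t < 1 -> f t = g t) ->
  f 1 = g 1.
Proof.
move=> cf cg fg; apply/eqP; rewrite -subr_eq0; apply/eqP.
apply: (@closed_left_end _ [set 0] (fun t => f t - g t)).
- apply: accessible_closed_set1; apply: hausdorff_accessible.
  exact: (@norm_hausdorff C C).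
- by move=> t; apply: cvgB; [exact: cf|exact: cg].
- by move=> t /fg ->; rewrite /= subrr.
Qed.

Lemma circle_loopE t : circle_loop t = cis (2 * pi * t) :> C.
Proof. by []. Qed.

Lemma continuous_circle_loop : continuous (circle_loop : R -> C).
Proof.
move=> t; apply: (@continuous_comp _ _ _ (fun t => 2 * pi * t) (@cis R)).
  by apply: cvgM; [exact: cvg_cst|exact: cvg_id].
exact: continuous_cis.
Qed.

Lemma norm_circle_loop t : `|circle_loop t : C| = 1.
Proof. exact: norm_cis. Qed.

Lemma circle_loop0 : circle_loop 0 = 1 :> C.
Proof. by rewrite circle_loopE mulr0 cis0. Qed.

Lemma circle_loop1 : circle_loop 1 = 1 :> C.
Proof. by rewrite circle_loopE (cis_2pi 1). Qed.

Lemma cis_mulrn t n : cis (t * n%:R) = cis t ^+ n :> C.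
Proof.
elim: n => [|n IH]; first by rewrite mulr0 cis0.
by rewrite -(natr1 n) mulrDr mulr1 cisD IH exprSr.
Qed.

Lemma unimodular_conj_quotient c : c != 0 -> exists t, c^* / c = cis t.
Proof.
move=> c0; apply: cis_surjective.
by rewrite normrM normfV norm_conjC divff // normr_eq0.
Qed.

(** Each factor [z - r] is a constant times [1 - z / r], which stays in the
    right half-plane, so its argument does not wind. *)
Lemma conj_quotient_lift (rs : seq C) : (forall r, r \in rs -> 1 < `|r|) ->
  exists th : R -> R, [/\ continuous th, th 1 = th 0 &
    forall t, let v := \prod_(r <- rs) (circle_loop t - r) in v^* / v = cis (th t)].
Proof.
elim: rs => [|r rs IH] out.
  exists (cst 0); split=> //; first exact: cst_continuous.
  by move=> t /=; rewrite big_nil conjC1 divr1 cis0.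
have [|th [cth th01 thE]] := IH.
  by move=> s srs; apply: out; rewrite inE srs orbT.
have r1 : 1 < `|r| by apply: out; rewrite mem_head.
have r0 : r != 0 by rewrite -normr_gt0 (lt_trans ltr01).
have [al cE] : exists al, (- r)^* / (- r) = cis al.
  by apply: unimodular_conj_quotient; rewrite oppr_eq0.
pose w (t : R) : C := 1 - circle_loop t / r.
have cw : continuous w.
  move=> t; apply: cvgB; first exact: cvg_cst.
  by apply: cvgM; [exact: continuous_circle_loop|exact: cvg_cst].
have wre t : 0 < complex.Re (w t).
  have : `|1 - w t| < 1.
    rewrite /w opprB addrC subrK normrM normfV norm_circle_loop mul1r.
    by rewrite invf_lt1 // (lt_trans ltr01).
  move=> /(le_lt_trans (norm_Re_le _)); rewrite ltcR raddfB /=.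
  by move=> /(le_lt_trans (ler_norm _)); lra.
exists (fun t => al - 2 * half_arg (w t) + th t); split.
- move=> t; apply: cvgD; last exact: cth.
  apply: cvgB; first exact: cvg_cst.
  apply: cvgM; first exact: cvg_cst.
  by apply: (@cvg_half_arg _ _ _ _ w) => //; exact: cw.
- by rewrite th01 /w circle_loop0 circle_loop1.
move=> t /=; rewrite big_cons.
have -> : circle_loop t - r = (- r) * w t by rewrite /w; field.
rewrite !rmorphM /= !invfM mulrACA cisD -thE; congr (_ * _).
rewrite mulrACA cE cisD; congr (_ * _).
rewrite [in LHS](half_argP (wre t)) rmorphM /= conj_cis.
have w0 : `|w t| != 0.
  rewrite normr_eq0; apply/eqP => w0; have := wre t; by rewrite w0 ltxx.
rewrite (CrealP (normr_real _)) invfM cis_inv mulrACA divff // mul1r -cisD.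
by congr cis; ring.
Qed.

(** On the circle [D~ / D = z ^+ n * D^* / D], and [D^* / D] does not wind. *)
Lemma winding_blaschke n D : (size D <= n.+1)%N ->
  (forall z, root D z -> 1 < `|z|) ->
  winding (fun t : R => (revpoly n D).[circle_loop t] / D.[circle_loop t]) = n.
Proof.
move=> sD rD.
have D0 : D != 0.
  by apply/eqP => D0; have := rD 0; rewrite D0 root0 normr0 ltr10 => /(_ isT).
have [rs DE] := closed_field_poly_normal D.
have lc0 : lead_coef D != 0 by rewrite lead_coef_eq0.
have [th [cth th01 thE]] : exists th : R -> R, [/\ continuous th, th 1 = th 0 &
    forall t, let v := \prod_(r <- rs) (circle_loop t - r) in v^* / v = cis (th t)].
  by apply: conj_quotient_lift => r rrs; apply: rD; rewrite DE rootZ // root_prod_XsubC.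
have [al cE] := unimodular_conj_quotient lc0.
apply: (@winding_def _ _ (fun t => 2 * pi * t * n%:R + al + th t)).
  split.
    move=> t; apply: cvgD; last exact: cth.
    apply: cvgD; last exact: cvg_cst.
    apply: cvgM; last exact: cvg_cst.
    by apply: cvgM; [exact: cvg_cst|exact: cvg_id].
  move=> t _ /=; rewrite revpoly_circle ?norm_circle_loop // !cisD. rewrite cis_mulrn.
  rewrite -circle_loopE -!mulrA; congr (_ * _).
  rewrite -cE -thE /= DE hornerZ horner_prod lead_coefZ.
  rewrite (monicP (monic_prod_XsubC _ _ _)) mulr1.
  under eq_bigr do rewrite hornerXsubC.
  by rewrite rmorphM /= invfM mulrACA.
by rewrite th01; rewrite -pmulrn; ring.
Qed.

End Degree.

(** * Rational Gamma-inner functions *)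

Section RationalInner.
Context {R : realType}.
Local Notation C := (Cplx R).
Implicit Types (h : C -> C * C) (z w c : C) (n : nat) (D E : {poly C}).

Lemma circle_cdisc z : circle z -> cdisc z.
Proof. by rewrite /circle /cdisc /= => ->. Qed.

Lemma cdiscP z : cdisc z -> disc z \/ circle z.
Proof.
rewrite /cdisc /disc /circle /= le_eqVlt => /orP[/eqP->|]; by [right|left].
Qed.

Lemma within_continuous_fst h :
  {within cdisc, continuous h} -> {within cdisc, continuous (fun z => (h z).1)}.
Proof.
move=> ch z; apply: (@continuous_comp (subspace cdisc) _ _ h fst).
  exact: ch.
exact: cvg_fst.
Qed.

Lemma within_continuous_snd h :
  {within cdisc, continuous h} -> {within cdisc, continuous (fun z => (h z).2)}.
Proof.
move=> ch z; apply: (@continuous_comp (subspace cdisc) _ _ h snd).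
  exact: ch.
exact: cvg_snd.
Qed.

(** Radial path to a boundary point, staying in the closed disc. *)
Definition radius z (t : R) : C := ((clamp t)%:C)%C * z.

Lemma continuous_radius z : continuous (radius z).
Proof.
move=> t; apply: cvgM; last exact: cvg_cst.
by apply: cvg_real; exact: continuous_clamp.
Qed.

Lemma norm_radius z t : circle z -> `|radius z t| = ((clamp t)%:C)%C.
Proof.
move=> z1; rewrite normrM z1 mulr1 norm_real ger0_norm //.
by have /andP[] := clamp_itv t.
Qed.

Lemma radius_cdisc z t : circle z -> cdisc (radius z t).
Proof.
move=> z1; rewrite /cdisc /= norm_radius // lecR.
by have /andP[] := clamp_itv t.
Qed.

Lemma radius_disc z t : circle z -> 0 <= t < 1 -> disc (radius z t).
Proof.
move=> z1 /andP[t0 t1]; rewrite /disc /= norm_radius // clamp_id ?t0 ?ltW //.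
by rewrite ltcR.
Qed.

Lemma radius1 z : radius z 1 = z.
Proof. by rewrite /radius clamp1 mul1r. Qed.

Lemma continuous_on_radius (T : topologicalType) (f : C -> T) z :
  {within cdisc, continuous f} -> circle z -> continuous (f \o radius z).
Proof.
move=> cf z1; apply: continuous_retract cf; first exact: continuous_radius.
by move=> t; exact: radius_cdisc.
Qed.

Lemma closed_on_circle (T : topologicalType) (A : set T) (f : C -> T) z :
  closed A -> {within cdisc, continuous f} -> (forall w, disc w -> A (f w)) ->
  cdisc z -> A (f z).
Proof.
move=> cA cf fA /cdiscP[/fA//|z1].
rewrite -[z]radius1; apply: (@closed_left_end R _ _ (f \o radius z)) => //.
  exact: continuous_on_radius.
by move=> t t01; apply: fA; exact: radius_disc.
Qed.

(** In lowest terms a rational function that extends continuously to the closed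
    disc has no pole on the circle. *)
Lemma rational_lowest_terms (g : C -> C) : rational_analytic g ->
  {within cdisc, continuous g} ->
  exists a b : {poly C}, coprimep a b /\
    forall z, cdisc z -> b.[z] != 0 /\ g z = a.[z] / b.[z].
Proof.
move=> [a [b gab]] cg.
have b0 : b != 0.
  apply/eqP => b0; have := gab 0; rewrite /disc /= normr0 ltr01 => /(_ isT)[].
  by rewrite b0 horner0 eqxx.
have cab : coprimep (a %/ gcdp a b) (b %/ gcdp a b).
  by apply: coprimep_div_gcd; rewrite b0 orbT.
have aE := divpK (dvdp_gcdl a b); have bE := divpK (dvdp_gcdr a b).
set d := gcdp a b in cab aE bE; set a' := a %/ d in cab aE; set b' := b %/ d in cab bE.
exists a', b'; split=> // z hz.
have ab w : disc w -> b'.[w] != 0 /\ b'.[w] * g w = a'.[w].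
  move=> /gab[]; rewrite -aE -bE !hornerM mulf_eq0 negb_or => /andP[bw dw] ->.
  by split=> //; field; rewrite bw dw.
have gz : b'.[z] * g z = a'.[z].
  case: (cdiscP hz) => [/ab[]//|z1].
  rewrite -[z]radius1.
  apply: (@eq_left_end R (fun t => b'.[radius z t] * g (radius z t))
    (fun t => a'.[radius z t])).
  - move=> t; apply: cvgM; first by apply: cvg_horner; exact: continuous_radius.
    exact: continuous_on_radius.
  - by move=> t; apply: cvg_horner; exact: continuous_radius.
  - by move=> t t01; have [] := ab _ (radius_disc z1 t01).
have bz : b'.[z] != 0.
  apply/eqP => bz; move: gz; rewrite bz mul0r => /esym/eqP az.
  by have := coprimep_root cab (introT eqP (eqP az)); rewrite bz eqxx.
by split=> //; rewrite -gz mulrAC divff ?mul1r.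
Qed.

Lemma inner_loop h : rational_Gamma_inner h ->
  is_loop bGamma (h 1) (h \o circle_loop).
Proof.
move=> [_ _ _ ch hT]; split=> /=.
- apply: continuous_subspaceT; apply: continuous_retract ch.
    exact: continuous_circle_loop.
  by move=> t; apply: circle_cdisc; exact: norm_circle_loop.
- by rewrite circle_loop0.
- by rewrite circle_loop1.
- by move=> t _; apply: hT; exact: norm_circle_loop.
Qed.

(** The isomorphism in the definition of the degree may be taken to be the
    winding number, since any two differ by a sign. *)
Lemma degree_winding h : rational_Gamma_inner h ->
  degree h = `|winding (fun t : R => (h (circle_loop t)).2)|%N.
Proof.
move=> hin; have lh := inner_loop hin.
have b1 : bGamma (h 1) by case: hin => _ _ _ _; apply; exact: normr1.
have iso := bwinding_iso b1.
have uniq phi : pi1_iso_int bGamma (h 1) phi ->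
    `|phi (h \o circle_loop)|%N = `|bwinding (h \o circle_loop)|%N.
  move=> iphi; apply: (pi1_iso_int_unique _ iphi iso) => // a b.
  exact: loop_mulP.
rewrite /degree; case: xgetP => [n _ [phi iphi ->]|/(_ `|bwinding (h \o circle_loop)|%N)].
  exact: uniq.
by case; exists bwinding.
Qed.

Lemma Gamma_norm_le2 (sp : C * C) : Gamma sp -> `|sp.1| <= 2.
Proof.
move=> Gsp; rewrite real_leNgt ?normr_real ?rpred_nat //; apply/negP => s2.
have e0 : 0 < `|sp.1| - 2 by rewrite subr_gt0.
have nb : nbhs sp [set q : C * C | `|sp.1 - q.1| < `|sp.1| - 2].
  by have /cvgrPdist_lt/(_ _ e0) : (fst : C * C -> C) x @[x --> sp] --> sp.1
    by exact: cvg_fst.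
have [q [[z [w [z1 w1 ->]]] /=]] := Gsp _ nb.
apply/negP; rewrite -real_leNgt ?rpredB ?normr_real ?rpred_nat //.
rewrite lerBlDr -lerBlDl; apply: (le_trans (lerB_dist _ _)).
rewrite opprB addrC subrK; apply: (le_trans (ler_normD _ _)).
rewrite -[2]/(1 + 1 : C); apply: lerD; exact: ltW.
Qed.

(** [p] is a quotient [D~ / D] because it is unimodular on the circle, its
    winding number there gives the degree, and the symmetry of [s] puts [s]
    over the same denominator. *)
Lemma royal_pair_exists h : rational_Gamma_inner h ->
  exists E D, royal_pair h E D.
Proof.
move=> hin; have [r1 r2 hG ch hT] := hin.
have c1 : {within cdisc, continuous (fun z => (h z).1)}.
  exact: within_continuous_fst.
have c2 : {within cdisc, continuous (fun z => (h z).2)}.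
  exact: within_continuous_snd.
have [a1 [b1 [cab1 sE]]] := rational_lowest_terms r1 c1.
have [a2 [b2 [cab2 pE]]] := rational_lowest_terms r2 c2.
have [|n [w [w1 sb2 rev]]] := unimodular_quotient_rev cab2.
  move=> z z1; have [_ pz _] := hT z z1; have [bz] := pE z (circle_cdisc z1).
  move=> /(congr1 (fun x => `|x|)); rewrite pz normrM normfV => /esym/divr1_eq.
  by [].
pose D := w *: b2.
have w0 : w != 0 by exact: norm1_neq0.
have sD : (size D <= n.+1)%N by rewrite size_scale.
have pD z : cdisc z -> D.[z] != 0 /\ (h z).2 = (revpoly n D).[z] / D.[z].
  move=> /pE[bz ->]; rewrite rev !hornerZ mulf_neq0 //; split=> //.
  by field; rewrite w0 bz.
have out (b : {poly C}) : (forall z, cdisc z -> b.[z] != 0) ->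
    forall z, root b z -> 1 < `|z|.
  move=> bz z; rewrite real_ltNge ?rpred1 ?normr_real // => rz; apply/negP => z1.
  by have := bz z z1; rewrite (eqP rz) eqxx.
have rD : forall z, root D z -> 1 < `|z| by apply: out => z /pD[].
have rb1 : forall z, root b1 z -> 1 < `|z| by apply: out => z /sE[].
have dh : degree h = n.
  rewrite degree_winding //.
  have -> : (fun t : R => (h (circle_loop t)).2) =
      (fun t : R => (revpoly n D).[circle_loop t] / D.[circle_loop t]).
    apply/funext => t; have [] // := pD (circle_loop t).
    by apply: circle_cdisc; exact: norm_circle_loop.
  by rewrite (winding_blaschke sD rD).
have [|g Dg [sg rg]] := symmetric_numerator cab1 sD rb1.
  move=> z z1; have zc := circle_cdisc z1.
  have [b1z sz] := sE z zc; have [Dz pz] := pD z zc; have [_ _ ez] := hT z z1.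
  move: ez; rewrite sz pz rmorphM /= fmorphV /= => ez.
  have b1z' : (b1.[z])^* != 0 by rewrite conjC_eq0.
  transitivity (a1.[z] / b1.[z] * (b1.[z] * (b1.[z])^* * D.[z])).
    by field.
  by rewrite ez; field; rewrite b1z' Dz.
exists (g * a1), D; rewrite /royal_pair dh; split=> // z hz.
have [b1z sz] := sE z hz; have [Dz pz] := pD z hz.
have gz : g.[z] != 0 by move: Dz; rewrite Dg hornerM mulf_eq0 negb_or => /andP[].
have sz' : (h z).1 = (g * a1).[z] / D.[z].
  by rewrite sz Dg !hornerM; field; rewrite gz b1z.
split=> //; last by rewrite -sz' -pz -surjective_pairing.
have s2 : `|(h z).1| <= 2.
  case: (cdiscP hz) => [/hG/Gamma_norm_le2//|/hT[]//].
by move: s2; rewrite sz' normrM normfV ler_pdivrMr // normr_gt0.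
Qed.

End RationalInner.

(** * Zeros on the circle *)

Section CircleZeros.
Context {R : realType}.
Local Notation C := (Cplx R).
Implicit Types (z w c : C) (n : nat) (P : {poly C}).

(** Along the circle [cis t - 1 = 2 i sin (t / 2) cis (t / 2)] changes sign with
    [t], so a zero of odd order would make [P z / z ^+ n] change sign. *)
Lemma even_multiplicity P n z : P != 0 ->
  (forall w, `|w| = 1 -> 0 <= P.[w] / w ^+ n) -> `|z| = 1 -> ~~ odd (mup z P).
Proof.
move=> P0 Ppos z1; have [l [q]] := multiplicity_XsubC P z.
rewrite P0 /= => qz PE.
have -> : mup z P = l by rewrite PE mupMr // mup_XsubCX eqxx.
apply/negP => l_odd.
pose y (t : R) : C := z * cis t.
have y1 t : `|y t| = 1 by rewrite normrM z1 norm_cis mulr1.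
have y0 t : y t != 0 by exact: norm1_neq0.
pose k (t : R) : C := 2 * z * 'i%C * cis (t / 2).
pose G (t : R) : C := q.[y t] * k t ^+ l / y t ^+ n.
have yz t : y t - z = ((sin (t / 2))%:C)%C * k t.
  have -> : y t - z = z * (cis (t / 2 + t / 2) - 1) by rewrite -splitr /y; ring.
  have -> : (1 : C) = cis (t / 2) * cis (- (t / 2)) by rewrite -cisD subrr cis0.
  rewrite cisD -mulrBr.
  have -> : cis (t / 2) - cis (- (t / 2)) = 2 * 'i%C * ((sin (t / 2))%:C)%C :> C.
    rewrite /cis cosN sinN; apply/eqP; rewrite eq_complex /=.
    by apply/andP; split; apply/eqP; ring.
  by rewrite /k; ring.
have PG t : P.[y t] / y t ^+ n = ((sin (t / 2) ^+ l)%:C)%C * G t.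
  rewrite PE hornerM horner_exp hornerXsubC yz exprMn /G rmorphXn /=; ring.
have i0 : 'i%C != 0 :> C by rewrite eq_complex /= oner_eq0 andbF.
have k0 t : k t != 0.
  by rewrite /k !mulf_neq0 ?pnatr_eq0 ?cis_neq0 ?(norm1_neq0 z1).
have G0 : G 0 != 0.
  have yE : y 0 = z by rewrite /y cis0 mulr1.
  by rewrite /G !mulf_neq0 ?invr_eq0 ?expf_neq0 // yE -rootE.
have Gpos t : 0 < t < pi -> 0 <= G t.
  move=> /andP[t0 tpi]; have := Ppos _ (y1 t); rewrite PG pmulr_rge0 //.
  by rewrite ltcR exprn_gt0 // sin_gt0_pi //; apply/andP; split; lra.
have Gneg t : 0 < t < pi -> 0 <= - G (- t).
  move=> /andP[t0 tpi]; have := Ppos _ (y1 (- t)).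
  rewrite PG mulNr sinN exprNn -signr_odd l_odd expr1 mulN1r rmorphN /= mulNr -mulrN.
  rewrite pmulr_rge0 //.
  by rewrite ltcR exprn_gt0 // sin_gt0_pi //; apply/andP; split; lra.
have cy : continuous y.
  by move=> t; apply: cvgM; [exact: cvg_cst|exact: continuous_cis].
have cX (f : R -> C) m : continuous f -> continuous (fun t => f t ^+ m).
  move=> cf; elim: m => [|m IH].
    by under eq_fun do rewrite expr0; move=> t; exact: cvg_cst.
  under eq_fun do rewrite exprS.
  by move=> t; apply: cvgM; [exact: cf|exact: IH].
have ck : continuous k.
  move=> t; apply: cvgM; first exact: cvg_cst.
  apply: (@continuous_comp _ _ _ (fun t : R => t / 2) (@cis R)); last exact: continuous_cis.
  by apply: cvgM; [exact: cvg_id|exact: cvg_cst].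
have cG : continuous G.
  move=> t; apply: cvgM.
    by apply: cvgM; [apply: cvg_horner; exact: cy|exact: cX].
  by apply: cvgV; [rewrite expf_neq0|exact: cX].
have pi1 : (1 : R) < pi by have := pihalf_ge1 R; lra.
(* Approaching 0 from either side gives the two opposite signs. *)
have limit (s e : R) : (forall t, 0 < t < pi -> 0 <= (e%:C)%C * G (s * t)) ->
    (e%:C)%C * G 0 = `|(e%:C)%C * G 0|.
  move=> pos; pose f (t : R) : C := (e%:C)%C * G (s * (1 - t)).
  have cf : continuous f.
    move=> t; apply: cvgM; first exact: cvg_cst.
    apply: (@continuous_comp _ _ _ (fun t : R => s * (1 - t)) G); last exact: cG.
    apply: cvgM; first exact: cvg_cst.
    by apply: cvgB; [exact: cvg_cst|exact: cvg_id].
  have -> : (e%:C)%C * G 0 = f 1 by rewrite /f subrr mulr0.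
  apply: (@eq_left_end R f (fun t => `|f t|)) => [|t|t /andP[t0 t1]].
  - exact: cf.
  - by apply: (@cvg_norm C C); exact: cf.
  rewrite ger0_norm // /f; apply: pos; apply/andP; split; lra.
have e1 : G 0 = `|G 0|.
  have := @limit 1 1; rewrite rmorph1 !mul1r; apply => t /Gpos; by rewrite !mul1r.
have e2 : - G 0 = `|G 0|.
  have := @limit (- 1) (- 1); rewrite rmorphN rmorph1 !mulN1r normrN; apply => t /Gneg.
  by rewrite !mulN1r.
move: G0; rewrite -normr_eq0; move: e2; rewrite {1}e1 => /eqP.
by rewrite eq_sym -addr_eq0 -mulr2n mulrn_eq0 /= => ->.
Qed.

End CircleZeros.

(** * Royal nodes *)

Lemma sum_undup_count (T : eqType) (s : seq T) (P : pred T) :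
  (\sum_(x <- undup s | P x) count_mem x s)%N = count P s.
Proof.
rewrite -[RHS]sum1_count -[RHS](big_undup_iterop_count addn) /=.
apply: eq_bigr => x _; elim: (count_mem x s) => //= n IH.
by case: n IH => //= n <-; rewrite add1n.
Qed.

Section RoyalNodes.
Context {R : realType}.
Local Notation C := (Cplx R).
Implicit Types (h : C -> C * C) (z w c : C) (n : nat) (D E P : {poly C}).

Lemma mup_roots P (rs : seq C) z : P != 0 ->
  P = lead_coef P *: \prod_(r <- rs) ('X - r%:P) -> mup z P = count_mem z rs.
Proof.
move=> P0 ->; rewrite -mul_polyC mupMr ?mu_prod_XsubC //.
by rewrite rootC lead_coef_eq0.
Qed.

(** The zeros inside the disc and half of those on the circle make up half of
    the formal degree. *)
Lemma sum_multiplicities n P : P != 0 -> (size P <= (n + n).+1)%N ->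
  revpoly (n + n) P = P -> (forall z, `|z| = 1 -> ~~ odd (mup z P)) ->
  let A := [set z : C | cdisc z /\ root P z] in
  finite_set A /\
  \sum_(z \in A) (if `|z| < 1 then mup z P else (mup z P)./2) = n.
Proof.
move=> P0 sP rP ev A.
have [rs PE] := closed_field_poly_normal P.
have mE z := mup_roots z P0 PE.
have rE z : root P z = (z \in rs).
  by rewrite PE rootZ ?lead_coef_eq0 // root_prod_XsubC.
have AE : A = [set` [seq z <- undup rs | `|z| <= 1]].
  apply/seteqP; split=> z /=; rewrite mem_filter mem_undup -rE.
    by case=> z1 ->; rewrite andbT.
  by case/andP.
split; first by rewrite AE; exact: finite_seq.
rewrite AE -fsbig_seq ?filter_uniq ?undup_uniq // big_filter.
have cnt := self_reversed_root_count PE P0 sP rP.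
apply: double_inj; rewrite -[RHS]addnn -cnt -!sum_undup_count.
rewrite (bigID (fun z => `|z| < 1)) /= doubleD mul2n; congr (_.*2 + _)%N.
  apply: eq_big => [z|z /andP[_ z1]]; last by rewrite z1 mE.
  by rewrite andb_idl // => /ltW.
rewrite -mul2n big_distrr /=; apply: eq_big => [z|z /andP[z1 zn1]].
  rewrite lt_neqAle negb_and negbK andb_orr andbN orbF andb_idl //.
  by move=> /eqP->.
have zT : `|z| = 1.
  by apply/eqP; rewrite eq_le z1 real_leNgt ?rpred1 ?normr_real.
by rewrite (negPf zn1) -mE mul2n even_halfK // ev.
Qed.

Lemma royal_varietyP (s p : C) : royal_variety (s, p) <-> s ^+ 2 = 4 * p.
Proof.
split=> [[z [-> ->]]|e]; first by ring.
exists (s / 2); congr (_, _); first by field.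
by rewrite expr_div_n e; field.
Qed.

Lemma royal_variety_Gamma (sp : C * C) : royal_variety sp -> Gamma sp ->
  exists2 c, `|c| <= 1 & sp = (2 * c, c ^+ 2).
Proof.
move=> [c ->] /Gamma_norm_le2 /= c2; exists c => //.
by move: c2; rewrite normrM normr_nat -{2}[2]mulr1 ler_pM2l.
Qed.

Lemma inner_Gamma h z : rational_Gamma_inner h -> cdisc z -> Gamma (h z).
Proof.
move=> [_ _ hG ch _]; apply: closed_on_circle => //; exact: closed_closure.
Qed.

(** If [s ^+ 2 = 4 p] throughout, then [s / 2] is a nonconstant rational
    function of modulus 1 on the circle, so it maps the closed disc onto
    itself. *)
Lemma royal_inner_image h : rational_Gamma_inner h -> nonconstant h ->
  (forall z, cdisc z -> royal_variety (h z)) ->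
  h @` cdisc = royal_variety `&` Gamma.
Proof.
move=> hin hnc hR; apply/seteqP; split=> [_ [z hz <-]|sp [spR spG]].
  by split; [exact: hR|exact: inner_Gamma].
have [c c1 ->] := royal_variety_Gamma spR spG.
have [r1 _ _ ch hT] := hin.
have c1' : {within cdisc, continuous (fun z => (h z).1)}.
  exact: within_continuous_fst.
have [a [b [cab sE]]] := rational_lowest_terms r1 c1'.
have hE z : cdisc z -> h z = ((h z).1, ((h z).1 / 2) ^+ 2).
  by move=> /hR[w ->] /=; congr (_, _); field.
have two0 : 2 != 0 :> C by rewrite pnatr_eq0.
have cab2 : coprimep a (2 *: b) by rewrite coprimepZr.
have [|n [w [w1 sb rev]]] := unimodular_quotient_rev cab2.
  move=> z z1; have zc := circle_cdisc z1; have [bz sz] := sE z zc.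
  have [_ p1 _] := hT z z1; move: p1; rewrite hE //= normrX => /eqP.
  rewrite pexpr_eq1 // sz !normrM !normfV -mulrA -invfM => /eqP/divr1_eq ->.
  by rewrite hornerZ normrM mulrC.
have w0 : w != 0 by exact: norm1_neq0.
set B := w *: (2 *: b) in rev.
have sB : (size B <= n.+1)%N by rewrite size_scale.
have Bz z : cdisc z -> B.[z] != 0 /\ (h z).1 / 2 = (revpoly n B).[z] / B.[z].
  move=> /sE[bz ->]; rewrite rev !hornerZ !mulf_neq0 //; split=> //.
  by field; rewrite w0 bz.
have n_gt0 : (0 < n)%N.
  rewrite lt0n; apply/eqP => n0; apply: hnc.
  have cst (p : {poly C}) z : (size p <= 1)%N -> p.[z] = p`_0.
    by move=> /size1_polyC ->; rewrite hornerC coefC.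
  exists (h 0) => z hz.
  have q z' : cdisc z' -> (h z').1 = (revpoly n B)`_0 / B`_0 * 2.
    move=> /Bz[_]; rewrite !cst -?n0 ?size_revpoly // => <-.
    by rewrite divfK.
  have zc : cdisc z by exact: ltW.
  have oc : cdisc (0 : C) by rewrite /cdisc /= normr0 ler01.
  by rewrite hE // [RHS]hE // !q.
have rB z : root B z -> 1 < `|z|.
  rewrite real_ltNge ?rpred1 ?normr_real // => rz; apply/negP => /Bz[].
  by rewrite (eqP rz) eqxx.
have [z zc zE] := blaschke_surjective n_gt0 sB rB c1.
exists z => //; have [Bz0 q] := Bz z zc.
rewrite hE // q zE mulfK //; congr (_, _).
by rewrite -[LHS](divfK two0) q zE mulfK // mulrC.
Qed.

(** On the circle [D~ = z ^+ n * D^*] and [E = z ^+ n * E^*]. *)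
Lemma self_reversed_royal n D E : (size E <= n.+1)%N -> (size D <= n.+1)%N ->
  revpoly n E = E ->
  let P := 4 *: (D * revpoly n D) - E ^+ 2 in
  [/\ (size P <= (n + n).+1)%N, revpoly (n + n) P = P &
    forall z, `|z| = 1 -> P.[z] / z ^+ n = 4 * `|D.[z]| ^+ 2 - `|E.[z]| ^+ 2].
Proof.
move=> sE sD rE P.
have PT z : `|z| = 1 -> P.[z] = z ^+ n * (4 * `|D.[z]| ^+ 2 - `|E.[z]| ^+ 2).
  move=> z1; rewrite /P hornerD hornerN hornerZ hornerM revpoly_circle //.
  rewrite horner_exp expr2 -{2}rE revpoly_circle // !normCK; ring.
have [|sP rP] := @self_reversed _ (n + n) P.
  move=> z z1; rewrite PT // rmorphM /=.
  have /CrealP -> : 4 * `|D.[z]| ^+ 2 - `|E.[z]| ^+ 2 \is Num.real.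
    by rewrite rpredB // ?rpredM ?rpredX ?rpred_nat ?normr_real.
  rewrite exprD -!mulrA; congr (_ * _); rewrite mulrA rmorphXn -exprMn.
  by rewrite norm1_mul_conj // expr1n mul1r.
split=> // z z1; rewrite PT // mulrC mulKf // expf_neq0 //; exact: norm1_neq0.
Qed.



End RoyalNodes.

Theorem theorem1p1 (R : realType) (h : Cplx R -> Cplx R * Cplx R)
  (h_inner : rational_Gamma_inner h) (h_nonconstant : nonconstant h) :
  h @` cdisc = royal_variety `&` Gamma \/ meets_royal_times h (degree h).
Proof.
pose ED := xget (0, 0) [set ED | royal_pair h ED.1 ED.2].
have [sE sD rE hED] : royal_pair h ED.1 ED.2.
  have [E [D pED]] := royal_pair_exists h_inner.
  apply: (@xgetPex _ (0, 0) [set ED | royal_pair h ED.1 ED.2]).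
  by exists (E, D).
set n := degree h in sE sD rE hED *.
have [sP rP PT] := self_reversed_royal sE sD rE.
have PE : royal_poly h = 4 *: (ED.2 * revpoly n ED.2) - ED.1 ^+ 2 by [].
rewrite -PE in sP rP PT.
have nodeP z : cdisc z -> royal_variety (h z) <-> root (royal_poly h) z.
  move=> /hED[Dz _ ->]; rewrite royal_varietyP rootE PE.
  rewrite hornerD hornerN hornerZ hornerM horner_exp subr_eq0.
  split=> [e|/eqP e].
    rewrite mulrCA -[X in _ == X](divfK (expf_neq0 2 Dz)) -expr_div_n e.
    by apply/eqP; field.
  by rewrite expr_div_n -e; field.
have [P0|P0] := eqVneq (royal_poly h) 0.
  left; apply: royal_inner_image => // z zc.
  by apply/nodeP; rewrite // P0 root0.
right; have nodesE : royal_nodes h = [set z | cdisc z /\ root (royal_poly h) z].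
  by apply/seteqP; split=> z [zc hz]; split=> //; apply/(nodeP z zc).
rewrite /meets_royal_times nodesE; apply: sum_multiplicities => // z.
apply: (@even_multiplicity _ _ n) => // w w1.
rewrite PT // subr_ge0; have [_ + _] := hED w (circle_cdisc w1).
rewrite (_ : 4 * _ = (2 * `|ED.2.[w]|) ^+ 2); last by ring.
by rewrite ler_sqr ?nnegrE ?mulr_ge0.
Qed.
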